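(* Let $k$ be an algebraically closed field of characteristic zero, $n\ge1$, $q\in k$ a primitive $2n$-th root of unity, $a\in k\setminus\{0\}$. Let $\mathfrak wH_{4n}$ be the weak Hopf algebra generated by $Z,X$ with $Z^{2n+1}=Z$, $ZX=qXZ$, $X^2=0$, $\Delta(Z)=Z\otimes Z+a(1-q^{-2})Z^{n+1}X\otimes ZX$, $\Delta(X)=X\otimes 1+Z^n\otimes X$, $\epsilon(Z)=1$, $\epsilon(X)=0$, $T(Z)=Z^{2n-1}$, $T(X)=-Z^nX$. Then the Green ring $r(\mathfrak wH_{4n})$ is isomorphic to the quotient of the free (noncommutative) ring $\mathbb Z\langle x_1,x_2,x_3\rangle$ by the two-sided ideal generated by $$x_1^{2n}-1,\ x_2^2-x_1x_2-x_2,\ x_1x_2-x_2x_1,\ x_3^2-x_3,\ x_1x_3-x_3,\ x_3x_1-x_3,\ x_3x_2-2x_3,$$ via $x_1\mapsto[S_1]$, $x_2\mapsto[M_0]$, $x_3\mapsto[N_0]$, where $S_1$ is the $1$-dimensional module with $X$ acting by $0$ and $Z$ by $q$, $M_0$ is the $2$-dimensional module with basis $v_1,v_2$, $Xv_1=v_2$, $Xv_2=0$, $Zv_1=v_1$, $Zv_2=qv_2$, and $N_0$ is the $1$-dimensional module on which $Z,X$ act by $0$.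
   Context: The Green ring $r(A)$ of $A=\mathfrak wH_{4n}$ is the free abelian group on isomorphism classes $[M]$ of finite-dimensional $A$-modules modulo $[M\oplus N]=[M]+[N]$, with multiplication $[M][N]=[M\otimes N]$ where $M\otimes N$ is an $A$-module via $\Delta$. *)

(* Defs.v *)
From HB Require Import structures.
From mathcomp Require Import all_boot all_order all_algebra all_field.
From mathcomp Require Import mxtens.
From Stdlib Require List.
Set Implicit Arguments.
Unset Strict Implicit.
Unset Printing Implicit Defensive.
Import GRing.Theory.
Local Open Scope ring_scope.

(* A finite-dimensional representation given by the matrices (acting on
   column vectors of k^rdim) by which the generators Z and X act. *)
Record rawmod (k : fieldType) := RawMod { rdim : nat; rZ : 'M[k]_rdim; rX : 'M[k]_rdim }.

Section WH.
Variables (k : fieldType) (n : nat) (q a : k).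

(* An A-module, A = wH_{4n} = k<Z,X>/(Z^{2n+1}=Z, ZX=qXZ, X^2=0):
   a unital algebra map A -> M_d(k), i.e. matrices satisfying the relations. *)
Definition is_wHmod (M : rawmod k) : Prop :=
  [/\ rZ M ^+ (2 * n).+1 = rZ M,
      rZ M *m rX M = q *: (rX M *m rZ M)
    & rX M *m rX M = 0].

Definition mod_iso (M N : rawmod k) : Prop :=
  exists P : 'M[k]_(rdim N, rdim M),
    [/\ row_free P && row_full P,
        P *m rZ M = rZ N *m P
      & P *m rX M = rX N *m P].

Definition dsum (M N : rawmod k) : rawmod k :=
  @RawMod k (rdim M + rdim N) (block_mx (rZ M) 0 0 (rZ N)) (block_mx (rX M) 0 0 (rX N)).

(* Tensor product via the comultiplication
   Delta(Z) = Z (x) Z + a(1-q^{-2}) Z^{n+1}X (x) ZX,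
   Delta(X) = X (x) 1 + Z^n (x) X. *)
Definition tens (M N : rawmod k) : rawmod k :=
  @RawMod k (rdim M * rdim N)
    (tensmx (rZ M) (rZ N)
       + (a * (1 - q ^- 2)) *: tensmx (rZ M ^+ n.+1 *m rX M) (rZ N *m rX N))
    (tensmx (rX M) (1%:M) + tensmx (rZ M ^+ n) (rX N)).

(* The trivial module k_epsilon (unit of the Green ring): eps(Z)=1, eps(X)=0. *)
Definition triv : rawmod k := @RawMod k 1 1%:M 0.
Definition S1 : rawmod k := @RawMod k 1 (q%:M) 0.
Definition N0 : rawmod k := @RawMod k 1 0 0.
(* M_0 : basis v1 = e_0, v2 = e_1; X v1 = v2, X v2 = 0, Z v1 = v1, Z v2 = q v2. *)
Definition M0 : rawmod k :=
  @RawMod k 2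
    (\matrix_(i < 2, j < 2) (if i == j then (if i == 0 then 1 else q) else 0))
    (\matrix_(i < 2, j < 2) (((i == 1 :> nat) && (j == 0 :> nat))%:R)).

(* Elements of the free abelian group on modules: formal Z-combinations. *)
Definition fsum := seq (int * rawmod k).

(* Equality in the Green ring r(A): the congruence on formal sums generated by
   the free-abelian-group identities (commutativity, collecting coefficients,
   dropping zero terms), identification of isomorphic modules, and
   [M (+) N] = [M] + [N]. *)
Inductive green_eq : fsum -> fsum -> Prop :=
| geq_refl s : green_eq s s
| geq_sym s t : green_eq s t -> green_eq t s
| geq_trans s t u : green_eq s t -> green_eq t u -> green_eq s u
| geq_cat s1 s2 t1 t2 : green_eq s1 t1 -> green_eq s2 t2 -> green_eq (s1 ++ s2) (t1 ++ t2)
| geq_swap x y : green_eq [:: x; y] [:: y; x]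
| geq_merge (c d : int) M : green_eq [:: (c, M); (d, M)] [:: (c + d, M)]
| geq_zero M : green_eq [:: (0%R, M)] [::]
| geq_iso (c : int) M N : is_wHmod M -> is_wHmod N -> mod_iso M N ->
    green_eq [:: (c, M)] [:: (c, N)]
| geq_dsum (c : int) M N : is_wHmod M -> is_wHmod N ->
    green_eq [:: (c, dsum M N)] [:: (c, M); (c, N)].

Definition valid_fsum (s : fsum) : Prop := forall p, List.In p s -> is_wHmod p.2.

Definition fscale (c : int) (s : fsum) : fsum := [seq (c * p.1, p.2) | p <- s].
Definition gmul (s t : fsum) : fsum :=
  [seq (p.1 * r.1, tens p.2 r.2) | p <- s, r <- t].

(* Noncommutative polynomials Z<x1,x2,x3>: formal Z-combinations of words
   over 'I_3 (index 0 = x1, 1 = x2, 2 = x3). *)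
Definition ncpoly := seq (int * seq 'I_3).
Definition ncoef (f : ncpoly) (w : seq 'I_3) : int := \sum_(p <- f | p.2 == w) p.1.
Definition ncmul (f g : ncpoly) : ncpoly := [seq (p.1 * r.1, p.2 ++ r.2) | p <- f, r <- g].

Definition x1 : 'I_3 := @Ordinal 3 0 isT.
Definition x2 : 'I_3 := @Ordinal 3 1 isT.
Definition x3 : 'I_3 := @Ordinal 3 2 isT.

Definition relator (j : 'I_7) : ncpoly :=
  match val j with
  | 0 => [:: (1, nseq (2 * n) x1); (-1, [::])]
  | 1 => [:: (1, [:: x2; x2]); (-1, [:: x1; x2]); (-1, [:: x2])]
  | 2 => [:: (1, [:: x1; x2]); (-1, [:: x2; x1])]
  | 3 => [:: (1, [:: x3; x3]); (-1, [:: x3])]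
  | 4 => [:: (1, [:: x1; x3]); (-1, [:: x3])]
  | 5 => [:: (1, [:: x3; x1]); (-1, [:: x3])]
  | _ => [:: (1, [:: x3; x2]); (-2, [:: x3])]
  end%R.

(* f lies in the two-sided ideal generated by the relators:
   f = sum_j c_j u_j r_{i_j} v_j  (as polynomials) with monomials u_j, v_j. *)
Definition in_rel_ideal (f : ncpoly) : Prop :=
  exists g : seq (int * seq 'I_3 * 'I_7 * seq 'I_3),
    forall w, ncoef f w =
      ncoef (flatten [seq ncmul [:: (e.1.1.1, e.1.1.2)]
                               (ncmul (relator e.1.2) [:: (1%R, e.2)]) | e <- g]) w.

Definition gen (i : 'I_3) : rawmod k :=
  match val i with 0 => S1 | 1 => M0 | _ => N0 end.

Fixpoint phi_word (w : seq 'I_3) : fsum :=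
  match w with
  | [::] => [:: (1%R, triv)]
  | i :: w' => gmul [:: (1%R, gen i)] (phi_word w')
  end.
Definition phi (f : ncpoly) : fsum := flatten [seq fscale p.1 (phi_word p.2) | p <- f].

End WH.

(* Main.v *)
(* Z^{2n} is a central idempotent, and Z is diagonalisable with eigenvalues in
   {0, 1, q, ..., q^{2n-1}}; splitting off a vector v with Xv <> 0 (or, if X = 0,
   an eigenvector of Z) shows that every module is a direct sum of the
   1-dimensional modules S(lam) and the 2-dimensional modules M(lam), X mapping
   the lam-eigenline onto the (q lam)-eigenline, for the 2n+1 values of lam
   (so N_0 = S(0)).  Ranks of polynomials in Z and X show that these 4n+2
   classes are linearly independent in the Green ring.

   Left multiplication by S_1, M_0, N_0 is an additive functor, computed on the
   basis by S_1 S(lam) = S(q lam), S_1 M(lam) = M(q lam), M_0 S(lam) = M(lam),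
   M_0 M(lam) = M(lam) + M(q lam), N_0 S(lam) = S(0), N_0 M(lam) = 2 S(0).
   Modulo the relators, left multiplication by x_1, x_2, x_3 obeys the same
   table on the words x_1^i, x_1^i x_2, x_3, x_2 x_3, and the relators act by
   zero on the free abelian group with this table.  So a polynomial and its
   image are both determined by the same normal form; associativity of the
   tensor product is never needed. *)
Require Import Defs.
From HB Require Import structures.
From mathcomp Require Import all_boot all_order all_algebra all_field.
From mathcomp Require Import mxtens ring.
Set Implicit Arguments.
Unset Strict Implicit.
Unset Printing Implicit Defensive.
Import GRing.Theory.
Local Open Scope ring_scope.

(** * Matrices and modules *)

Section TensorMatrices.
Variables (R : comNzRingType) (m n p r : nat).
Implicit Types (A : 'M[R]_(m, n)) (B : 'M[R]_(p, r)).

Lemma tensmxDr A B B' : tensmx A (B + B') = tensmx A B + tensmx A B'.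
Proof. by apply/matrixP=> i j; rewrite !mxE mulrDr. Qed.

Lemma tensmxZl c A B : tensmx (c *: A) B = c *: tensmx A B.
Proof. by apply/matrixP=> i j; rewrite !mxE mulrA. Qed.

Lemma tensmxZr c A B : tensmx A (c *: B) = c *: tensmx A B.
Proof. by apply/matrixP=> i j; rewrite !mxE mulrCA. Qed.

End TensorMatrices.

Lemma tensmx11 (R : comNzRingType) m p :
  tensmx (1%:M : 'M[R]_m) (1%:M : 'M[R]_p) = 1%:M.
Proof.
apply/matrixP=> i j; case: (mxtens_indexP i) (mxtens_indexP j) => i1 i2 [j1 j2].
by rewrite tensmxE !mxE (can_eq (@mxtens_indexK _ _)) xpair_eqE -natrM mulnb.
Qed.

Section MatrixPowers.
Context {R : comNzRingType}.

Lemma expmxS d (A : 'M[R]_d) m : A ^+ m.+1 = A *m A ^+ m.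
Proof. by rewrite exprS mulmxE. Qed.

Lemma expmxSr d (A : 'M[R]_d) m : A ^+ m.+1 = A ^+ m *m A.
Proof. by rewrite exprSr mulmxE. Qed.

Lemma expmx_intertwine d e (P : 'M[R]_(e, d)) (A : 'M_d) (B : 'M_e) m :
  P *m A = B *m P -> P *m A ^+ m = B ^+ m *m P.
Proof.
move=> PA; elim: m => [|m IHm]; first by rewrite !expr0 mulmx1 mul1mx.
by rewrite expmxS mulmxA PA -mulmxA IHm mulmxA -expmxS.
Qed.

Lemma expmx_qcommute d (A B : 'M[R]_d) c m :
  A *m B = c *: (B *m A) -> A ^+ m *m B = c ^+ m *: (B *m A ^+ m).
Proof.
move=> AB; elim: m => [|m IHm]; first by rewrite !expr0 scale1r mulmx1 mul1mx.
rewrite expmxS -mulmxA IHm -scalemxAr (mulmxA A) AB -scalemxAl scalerA -exprSr.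
by rewrite -mulmxA -expmxS.
Qed.

Lemma expmx_scalar d (c : R) m : (c%:M : 'M_d) ^+ m = (c ^+ m)%:M.
Proof.
by elim: m => [|m IHm] //; rewrite expmxS IHm -scalar_mxM -exprS.
Qed.

Lemma expmx_block d e (A : 'M[R]_d) (B : 'M[R]_e) m :
  block_mx A 0 0 B ^+ m = block_mx (A ^+ m) 0 0 (B ^+ m).
Proof.
elim: m => [|m IHm]; first by rewrite !expr0; apply: scalar_mx_block.
by rewrite expmxS IHm mulmx_block !(mulmx0, mul0mx, addr0, add0r) -!expmxS.
Qed.

Lemma tensmxX d e (A : 'M[R]_d) (B : 'M[R]_e) m :
  tensmx A B ^+ m = tensmx (A ^+ m) (B ^+ m).
Proof.
elim: m => [|m IHm]; first by rewrite !expr0 tensmx11.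
by rewrite !expmxS IHm tensmx_mul.
Qed.

(* As [B] has square zero, only words with at most one letter [B] survive. *)
Lemma expmx_nilp_qbinomial d (A B : 'M[R]_d) c m :
  B *m A = c *: (A *m B) -> B *m B = 0 ->
  (A + B) ^+ m.+1 = A ^+ m.+1 + (\sum_(i < m.+1) c ^+ i) *: (A ^+ m *m B).
Proof.
move=> BA BB; have BAm i : B *m A ^+ i = c ^+ i *: (A ^+ i *m B).
  elim: i => [|i IHi]; first by rewrite !expr0 scale1r mulmx1 mul1mx.
  rewrite expmxS mulmxA BA -scalemxAl -mulmxA IHi -scalemxAr scalerA -exprS.
  by rewrite mulmxA -expmxS.
elim: m => [|m IHm]; first by rewrite big_ord1 !expr1 expr0 scale1r mul1mx.
rewrite expmxS IHm mulmxDl !mulmxDr -!scalemxAr BAm (mulmxA A (A ^+ m)).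
rewrite (mulmxA B (A ^+ m)) BAm -(scalemxAl _ _ B) -(mulmxA _ B B) BB mulmx0.
rewrite !scaler0 addr0 -!expmxS -addrA -scalerDl.
by rewrite [in RHS]big_ord_recr.
Qed.

End MatrixPowers.

Section Modules.
Variables (k : fieldType) (n : nat) (q a : k).
Implicit Types M N B : rawmod k.
Notation wHmod := (is_wHmod n q).

Lemma mod_isoP M N : mod_iso M N <->
  exists P : 'M[k]_(rdim N, rdim M), exists Q : 'M[k]_(rdim M, rdim N),
    [/\ P *m Q = 1%:M, Q *m P = 1%:M, P *m rZ M = rZ N *m P
      & P *m rX M = rX N *m P].
Proof.
split=> [[P [/andP[Pfree Pfull] PZ PX]]|[P [Q [PQ QP PZ PX]]]].
  by exists P, (pinvmx P); rewrite mulmxVp ?mulVpmx.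
exists P; split=> //; apply/andP; split; first by apply/row_freeP; exists Q.
by apply/row_fullP; exists Q.
Qed.

Lemma eq_dim_mod_iso M N (P : 'M[k]_(rdim N, rdim M)) Q :
  rdim N = rdim M -> P *m Q = 1%:M -> P *m rZ M = rZ N *m P ->
  P *m rX M = rX N *m P -> mod_iso M N.
Proof.
move=> eq_d PQ PZ PX; exists P; split=> //; apply/andP.
have: row_free P by apply/row_freeP; exists Q.
by rewrite /row_free /row_full => /eqP->; rewrite eq_d.
Qed.

(** Each relation is checked after composing with [C], which cancels on the left because [R]
    retracts it. *)
Lemma wHmod_sub M N (C : 'M[k]_(rdim M, rdim N)) (R : 'M[k]_(rdim N, rdim M)) :
  wHmod M -> R *m C = 1%:M -> rZ M *m C = C *m rZ N -> rX M *m C = C *m rX N ->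
  wHmod N.
Proof.
move=> [MZ MZX MXX] RC CZ CX; have inj d (U V : 'M_(_, d)) : C *m U = C *m V -> U = V.
  by move=> CUV; rewrite -[U]mul1mx -[V]mul1mx -RC -!mulmxA CUV.
split; apply: inj.
- by rewrite (expmx_intertwine _ (esym CZ)) MZ.
- by rewrite -scalemxAr !mulmxA -CZ -CX -!mulmxA -CZ -CX !mulmxA MZX -scalemxAl.
- by rewrite mulmxA -CX -mulmxA -CX mulmxA MXX mul0mx mulmx0.
Qed.

Lemma wHmod_dsum M N : wHmod M -> wHmod N -> wHmod (dsum M N).
Proof.
move=> [MZ MZX MXX] [NZ NZX NXX].
split; rewrite /= ?expmx_block ?MZ ?NZ //.
  rewrite !mulmx_block !(mulmx0, mul0mx, addr0, add0r) scale_block_mx !scaler0.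
  by rewrite MZX NZX.
by rewrite !mulmx_block !(mulmx0, mul0mx, addr0, add0r) MXX NXX block_mx0.
Qed.


Lemma prim_root_neq0 (F : fieldType) m (z : F) : m.-primitive_root z -> z != 0.
Proof.
move=> z_prim; apply/eqP=> z0; have := prim_expr_order z_prim.
rewrite z0 expr0n gtn_eqF ?(prim_order_gt0 z_prim) // => /eqP.
by rewrite eq_sym oner_eq0.
Qed.

Lemma prim_root_half (F : fieldType) m (z : F) :
  (2 * m).-primitive_root z -> z ^+ m = -1.
Proof.
move=> z_prim; have := prim_order_gt0 z_prim; rewrite muln_gt0 /= => m_gt0.
have /eqP : z ^+ m ^+ 2 = 1 by rewrite -exprM mulnC prim_expr_order.
rewrite sqrf_eq1 => /orP[/eqP zm1|/eqP //].
have := prim_order_dvd z_prim m; rewrite zm1 eqxx => /dvdn_leq.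
by rewrite m_gt0 leqNgt => /(_ isT); rewrite -[X in (X < _)%N]mul1n ltn_pmul2r.
Qed.

(** Z acts by [A + B], where [B] comes from the second term of the coproduct, has square zero and
    commutes with [A] up to q^-2; the expansion of the power reduces Z^(2n+1) = Z to a geometric
    sum. *)
Lemma wHmod_tens M N : (2 * n).-primitive_root q -> wHmod M -> wHmod N ->
  wHmod (tens n q a M N).
Proof.
move=> q_prim [MZ MZX MXX] [NZ NZX NXX].
have [c c_def] : {c | c = a * (1 - q ^- 2)} by exists (a * (1 - q ^- 2)).
have n_gt0 : (0 < n)%N by move: (prim_order_gt0 q_prim); rewrite muln_gt0.
have qn2 : q ^+ (2 * n) = 1 := prim_expr_order q_prim.
have q_n0 : q != 0 := prim_root_neq0 q_prim.
have qn := prim_root_half q_prim.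
have qVq i : q ^- i * q ^+ i = 1 by rewrite mulVf ?expf_neq0.
have MZXi i := expmx_qcommute i MZX.
have MXZ : rX M *m rZ M = q^-1 *: (rZ M *m rX M).
  by rewrite MZX scalerA mulVf ?scale1r.
have NXZ : rX N *m rZ N = q^-1 *: (rZ N *m rX N).
  by rewrite NZX scalerA mulVf ?scale1r.
set A := tensmx (rZ M) (rZ N).
set B := c *: tensmx (rZ M ^+ n.+1 *m rX M) (rZ N *m rX N).
have BA : B *m A = q ^- 2 *: (A *m B).
  rewrite /A /B -scalemxAl -scalemxAr !tensmx_mul scalerA mulrC -scalerA.
  congr (_ *: _); rewrite -!mulmxA MXZ NXZ -!scalemxAr.
  rewrite tensmxZl tensmxZr scalerA -invfM -expr2 !mulmxA -expmxS -expmxSr //.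
have XZX i : rX M *m (rZ M ^+ i *m rX M) = 0.
  rewrite mulmxA -[rX M *m _ ^+ _]scale1r -(qVq i) -scalerA -MZXi -scalemxAl.
  by rewrite -mulmxA MXX mulmx0 scaler0.
have NXZX : rX N *m (rZ N *m rX N) = 0.
  by rewrite mulmxA NXZ -scalemxAl -mulmxA NXX mulmx0 scaler0.
have BB : B *m B = 0.
  rewrite /B -scalemxAl -scalemxAr tensmx_mul -mulmxA XZX mulmx0.
  by rewrite tens0mx !scaler0.
rewrite /tens -c_def; split=> /=; rewrite -/A -/B.
- rewrite (expmx_nilp_qbinomial _ BA BB) tensmxX MZ NZ; congr (_ + _).
  have qV2 : q ^- 2 ^+ (2 * n) = 1 by rewrite exprVn exprAC qn2 expr1n invr1.
  (* The first 2n terms, multiplied by the factor 1 - q^-2 of [c], telescope to zero; the last term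
     is 1. Nothing is divided by 1 - q^-2, which vanishes for n = 1. *)
  have sum_c : (\sum_(i < (2 * n).+1) q ^- 2 ^+ i) * c = c.
    rewrite big_ord_recr /= qV2 mulrDl mul1r.
    rewrite -[RHS]add0r; congr (_ + _); apply/eqP.
    rewrite mulrC c_def -mulrA -(opprB (q ^- 2)) mulNr -subrX1.
    by rewrite qV2 subrr oppr0 mulr0.
  rewrite /B -scalemxAr scalerA sum_c; congr (_ *: _).
  have Z2n : rZ M ^+ (2 * n) *m rZ M ^+ n.+1 = rZ M ^+ n.+1.
    by rewrite !mulmxE -exprD addnS -addSn exprD MZ -exprS.
  by rewrite /A tensmxX tensmx_mul !mulmxA -expmxSr NZ Z2n.
- rewrite !mulmxDl !mulmxDr /B -!scalemxAl -!scalemxAr /A !tensmx_mul.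
  rewrite XZX NXZX -!mulmxA MXX NXX !(mulmx0, tens0mx, tensmx0, scaler0, addr0).
  by rewrite mulmx1 mul1mx scalerDr -tensmxZl -tensmxZr MZX NZX -expmxS -expmxSr.
(* The surviving cross terms XZ^n ⊗ X and Z^n X ⊗ X cancel because q^n = -1. *)
- rewrite !mulmxDl !mulmxDr !tensmx_mul MXX NXX !(mulmx1, mul1mx, tens0mx, tensmx0).
  by rewrite addr0 add0r MZXi qn tensmxZl scaleN1r subrr.
Qed.

End Modules.

(** * The functor [tens G] and splitting of retracts *)

(** For the rank factorization E = CR, idempotence reads CRCR = CR; [C] has full column rank and [R]
    full row rank, so both cancel and leave RC = 1. *)
Lemma idempotent_factor (F : fieldType) d (E : 'M[F]_d) : E *m E = E ->
  exists r, exists C : 'M_(d, r), exists R : 'M_(r, d), C *m R = E /\ R *m C = 1%:M.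
Proof.
move=> EE; exists (\rank E), (col_base E), (row_base E); split; first exact: mulmx_base.
apply: (row_free_inj (row_base_free E)); apply: (row_full_inj (col_base_full E)).
by rewrite mul1mx -mulmxA mulmx_base mulmxA mulmx_base EE.
Qed.

Section GreenFunctor.
Variables (k : fieldType) (n : nat) (q a : k).
Implicit Types M N B G : rawmod k.
Notation wHmod := (is_wHmod n q).
Notation tens := (tens n q a).

Lemma tens_mod_iso G M N : mod_iso M N -> mod_iso (tens G M) (tens G N).
Proof.
case/mod_isoP=> P [Q [PQ QP PZ PX]]; apply/mod_isoP.
exists (tensmx 1%:M P), (tensmx 1%:M Q).
rewrite !tensmx_mul PQ QP !mulmx1 !tensmx11 /tens; split=> //=.
  rewrite mulmxDr mulmxDl -scalemxAr -scalemxAl !tensmx_mul.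
  by rewrite !(mul1mx, mulmx1) PZ mulmxA PZ -!mulmxA PX.
by rewrite mulmxDr mulmxDl !tensmx_mul !(mul1mx, mulmx1) PX.
Qed.

(** The isomorphism stacks the maps 1 ⊗ projection, its inverse the maps 1 ⊗ inclusion; the outer
    index is that of [G], so the sum is not visibly in block form. *)
Lemma tens_dsum G M N : mod_iso (tens G (dsum M N)) (dsum (tens G M) (tens G N)).
Proof.
set g := rdim G; apply/mod_isoP.
exists (col_mx (tensmx (1%:M : 'M_g) (row_mx 1%:M 0))
               (tensmx (1%:M : 'M_g) (row_mx 0 1%:M))).
exists (row_mx (tensmx (1%:M : 'M_g) (col_mx 1%:M 0))
               (tensmx (1%:M : 'M_g) (col_mx 0 1%:M))).
split=> /=.
- rewrite mul_col_row !tensmx_mul !mul_row_col !(mulmx1, mul1mx, mulmx0, mul0mx).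
  by rewrite !(addr0, add0r) !tensmx11 !tensmx0 -scalar_mx_block.
- rewrite mul_row_col !tensmx_mul -tensmxDr !mulmx1 !mul_col_row.
  rewrite !(mulmx1, mul1mx, mulmx0, mul0mx) add_block_mx !(addr0, add0r).
  by rewrite -scalar_mx_block tensmx11.
- rewrite mulmx_block mul_col_mx mul_block_col !mul0mx addr0 add0r.
  rewrite !(mulmxDr, mulmxDl) -!scalemxAr -!scalemxAl !tensmx_mul !mul_row_block.
  by rewrite !mul_mx_row !(mulmx1, mul1mx, mulmx0, mul0mx, addr0, add0r).
- rewrite [LHS]mul_col_mx mul_block_col !mul0mx addr0 add0r !(mulmxDr, mulmxDl).
  rewrite !tensmx_mul !mul_row_block !mul_mx_row.
  by rewrite !(mulmx1, mul1mx, mulmx0, mul0mx, addr0, add0r).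
Qed.

(** Tensoring on the left by a fixed module suffices, since [phi_word] multiplies by one generator
    at a time from the left. *)
Lemma green_tens G (s t : fsum k) : (2 * n).-primitive_root q -> wHmod G ->
  green_eq n q s t ->
  green_eq n q [seq (p.1, tens G p.2) | p <- s] [seq (p.1, tens G p.2) | p <- t].
Proof.
move=> q_prim hG; have hT M : wHmod M -> wHmod (tens G M) by apply: wHmod_tens.
elim=> {s t} [s|s t _ IH|s t u _ IH1 _ IH2|s1 s2 t1 t2 _ IH1 _ IH2|x y|c d M|M
             |c M N hM hN MN|c M N hM hN].
- exact: geq_refl.
- exact: geq_sym.
- exact: geq_trans IH2.
- by rewrite !map_cat; apply: geq_cat.
- exact: geq_swap.
- exact: geq_merge.
- exact: geq_zero.
- by apply: geq_iso; [apply: hT..|apply: tens_mod_iso].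
- apply: geq_trans (geq_dsum c (hT _ hM) (hT _ hN)).
  apply: geq_iso (tens_dsum _ _ _); first exact/hT/wHmod_dsum.
  by apply: wHmod_dsum; apply: hT.
Qed.

(** [U *m V] is an idempotent endomorphism whose image is a copy of [B]; the complement is the image
    of [F], with the actions transported through a rank factorization. *)
Lemma retract_dsum M B (U : 'M[k]_(rdim M, rdim B)) (V : 'M[k]_(rdim B, rdim M)) :
  wHmod M -> V *m U = 1%:M ->
  rZ M *m U = U *m rZ B -> rX M *m U = U *m rX B ->
  V *m rZ M = rZ B *m V -> V *m rX M = rX B *m V ->
  exists M', [/\ wHmod B, wHmod M', rdim M = (rdim B + rdim M')%N
               & mod_iso M (dsum B M')].
Proof.
move=> hM VU ZU XU VZ VX; pose F := 1%:M - U *m V.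
have FF : F *m F = F.
  rewrite /F mulmxBl mul1mx mulmxBr mulmx1 -(mulmxA U V) (mulmxA V U) VU mul1mx.
  by rewrite subrr subr0.
have ZF : rZ M *m F = F *m rZ M.
  by rewrite mulmxBl mulmxBr mul1mx mulmx1 mulmxA ZU -!mulmxA VZ.
have XF : rX M *m F = F *m rX M.
  by rewrite mulmxBl mulmxBr mul1mx mulmx1 mulmxA XU -!mulmxA VX.
have [r [C [R [CR RC]]]] := idempotent_factor FF.
have VF : V *m F = 0 by rewrite mulmxBr mulmx1 mulmxA VU mul1mx subrr.
have FU : F *m U = 0 by rewrite mulmxBl mul1mx -mulmxA VU mulmx1 subrr.
have VC : V *m C = 0 by rewrite -[V *m C]mulmx1 -RC !mulmxA -(mulmxA V) CR VF mul0mx.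
have RU : R *m U = 0 by rewrite -[R *m U]mul1mx -RC -!mulmxA (mulmxA C) CR FU mulmx0.
have FC : F *m C = C by rewrite -CR -mulmxA RC mulmx1.
have RF : R *m F = R by rewrite -CR mulmxA RC mul1mx.
pose M' := RawMod (R *m rZ M *m C) (R *m rX M *m C); exists M'.
have VRUC : col_mx V R *m row_mx U C = 1%:M.
  by rewrite mul_col_row VU VC RU RC -scalar_mx_block.
have UCVR : row_mx U C *m col_mx V R = 1%:M by rewrite mul_row_col CR addrC subrK.
have dimM : rdim M = (rdim B + r)%N.
  by apply/eqP; rewrite eqn_leq (mulmx1_min VRUC) (mulmx1_min UCVR).
split=> //.
- exact: (@wHmod_sub _ _ _ M _ U V).
- apply: (@wHmod_sub _ _ _ M M' C R hM RC) => /=; rewrite !mulmxA CR.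
    by rewrite -ZF -mulmxA FC.
  by rewrite -XF -mulmxA FC.
apply/mod_isoP; exists (col_mx V R), (row_mx U C); split=> //=.
- rewrite mul_col_mx mul_block_col !mul0mx addr0 add0r VZ.
  by rewrite -!mulmxA CR ZF mulmxA RF.
- rewrite mul_col_mx mul_block_col !mul0mx addr0 add0r VX.
  by rewrite -!mulmxA CR XF mulmxA RF.
Qed.

End GreenFunctor.

(** * Indecomposable modules *)

Lemma prim_root_neq1 (F : fieldType) m (z : F) :
  (2 * m).-primitive_root z -> z != 1.
Proof.
move=> z_prim; rewrite -[z]expr1 -(prim_order_dvd z_prim) dvdn1.
by rewrite -[X in _ != X]/1%N muln_eq1.
Qed.

Section Indecomposables.
Variables (k : fieldType) (n : nat) (q : k).
Hypothesis q_prim : (2 * n).-primitive_root q.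
Implicit Types (M : rawmod k) (lam : k).
Notation wHmod := (is_wHmod n q).

Definition simple_mod lam : rawmod k := @RawMod k 1 lam%:M 0.

Definition string_mod lam : rawmod k :=
  @RawMod k (1 + 1) (block_mx lam%:M 0 0 (q * lam)%:M) (block_mx 0 0 1%:M 0).

(* [(false, o)] stands for S(lam) and [(true, o)] for M(lam), where [lam] is
   [label_ev o]; the label [None] is the eigenvalue 0. *)
Definition label : finType := (bool * option 'I_(2 * n))%type.

Definition label_ev (o : option 'I_(2 * n)) : k := if o is Some i then q ^+ i else 0.

Definition label_mod (l : label) : rawmod k :=
  if l.1 then string_mod (label_ev l.2) else simple_mod (label_ev l.2).

Lemma label_ev_fix o : label_ev o ^+ (2 * n).+1 = label_ev o.
Proof.
case: o => [i|] /=; last by rewrite expr0n.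
by rewrite exprS exprAC (prim_expr_order q_prim) expr1n mulr1.
Qed.

Lemma label_evP lam : lam ^+ (2 * n).+1 = lam -> exists o, lam = label_ev o.
Proof.
have [->|lam_n0] := eqVneq lam 0; first by exists None.
rewrite exprS -[RHS]mulr1 => /(mulfI lam_n0)/(prim_rootP q_prim)[i ->].
by exists (Some i).
Qed.

Lemma label_ev_inj : injective label_ev.
Proof.
have q_n0 := prim_root_neq0 q_prim.
case=> [i|] [j|] //= => [/eqP|/eqP|/esym/eqP]; last 2 first.
- by rewrite expf_eq0 (negPf q_n0) andbF.
- by rewrite expf_eq0 (negPf q_n0) andbF.
by rewrite (eq_prim_root_expr q_prim) !modn_small // => /eqP/val_inj->.
Qed.


(** The roots of t^(2n+1) - t are the distinct label eigenvalues, so [A] is diagonalizable and its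
    left eigenspaces span; a nonzero [W] cannot kill them all. *)
Lemma eigen_row d m (A : 'M[k]_d) (W : 'M_(d, m)) :
  A ^+ (2 * n).+1 = A -> W != 0 ->
  exists o, exists u : 'rV_d, u *m A = label_ev o *: u /\ u *m W != 0.
Proof.
case: d => [|d] in A W *; first by rewrite [W]flatmx0 eqxx.
move=> AN W_n0.
have /diagonalizablePeigen[rs _ rsA] : diagonalizable A.
  apply/diagonalizableP; exists [seq label_ev o | o <- enum {: option 'I_(2 * n)}].
    by rewrite map_inj_uniq ?enum_uniq //; apply: label_ev_inj.
  apply: mxminpoly_min; rewrite big_map big_enum.
  have -> : \prod_o ('X - (label_ev o)%:P) = 'X * ('X^(2 * n) - 1).
    rewrite -(factor_Xn_sub_1 q_prim) big_mkord (bigD1 None) //= subr0; congr (_ * _).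
    rewrite (reindex_omap Some id) => [|[]//] /=.
    by apply: eq_bigl => i; rewrite eqxx.
  rewrite rmorphM /= rmorphB rmorphXn rmorph1 /= horner_mx_X mulrBr mulr1.
  by rewrite -exprS AN subrr.
have [mu mu_rs muW] : exists2 mu, mu \in rs & eigenspace A mu *m W != 0.
  apply/hasP; apply: contraNT W_n0 => /hasPn rsW.
  have : (1%:M <= kermx W)%MS.
    rewrite -rsA big_seq; elim/big_ind: _ => [|B C BW CW|mu /rsW/negPn/eqP muW].
    - exact: sub0mx.
    - by rewrite addsmx_sub BW.
    - by apply/sub_kermxP.
  by move/sub_kermxP; rewrite mul1mx => ->.
have [i iW] : exists i, row i (eigenspace A mu) *m W != 0.
  apply/existsP; apply: contraNT muW => /existsPn muW.
  by apply/eqP/row_matrixP => i; rewrite row_mul row0; apply/eqP/negPn.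
set u := row i _ in iW; have uA : u *m A = mu *: u.
  by apply/eigenspaceP; apply: row_sub.
have u_n0 : u != 0 by apply: contraNneq iW => ->; rewrite mul0mx.
(* Diagonalizability gives an unspecified list [rs]; the relation satisfied by [A] shows that [mu]
   is the eigenvalue of a label. *)
have uAi j : u *m A ^+ j = mu ^+ j *: u.
  elim: j => [|j IHj]; first by rewrite !expr0 mulmx1 scale1r.
  by rewrite expmxS mulmxA uA -scalemxAl IHj scalerA -exprS.
have [|o mu_o] := @label_evP mu.
  have := uAi (2 * n).+1; rewrite AN uA => /eqP.
  by rewrite -subr_eq0 -scalerBl scaler_eq0 (negPf u_n0) orbF subr_eq0 => /eqP.
by exists o, u; rewrite -mu_o.
Qed.

Lemma eigen_col d m (A : 'M[k]_d) (W : 'M_(m, d)) :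
  A ^+ (2 * n).+1 = A -> W != 0 ->
  exists o, exists v : 'cV_d, A *m v = label_ev o *: v /\ W *m v != 0.
Proof.
move=> AN W_n0; have trX j : A^T ^+ j = (A ^+ j)^T.
  elim: j => [|j IHj]; first by rewrite !expr0 [RHS]trmx1.
  by rewrite expmxS IHj -trmx_mul -expmxSr.
have [||o [u [uA uW]]] := @eigen_row d m A^T W^T.
- by rewrite trX AN.
- by rewrite -(inj_eq trmx_inj) trmxK trmx0.
exists o, u^T; rewrite -(trmxK A) -(trmxK W) -!trmx_mul uA.
split; first by apply/matrixP=> i j; rewrite !mxE.
by rewrite -(inj_eq trmx_inj) trmxK trmx0.
Qed.

Lemma wHmod_simple lam : lam ^+ (2 * n).+1 = lam -> wHmod (simple_mod lam).
Proof.
by move=> lamN; split; rewrite /= ?expmx_scalar ?lamN ?mulmx0 ?mul0mx ?scaler0.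
Qed.

Lemma wHmod_string lam : lam ^+ (2 * n).+1 = lam -> wHmod (string_mod lam).
Proof.
move=> lamN; split=> /=; rewrite ?expmx_block ?expmx_scalar ?exprMn ?lamN.
- by rewrite exprS (prim_expr_order q_prim) mulr1.
- rewrite !mulmx_block !(mulmx0, mul0mx, addr0, add0r) scale_block_mx !scaler0.
  by rewrite mul1mx mulmx1 scale_scalar_mx.
- by rewrite mulmx_block !(mulmx0, mul0mx, addr0, add0r) block_mx0.
Qed.

Lemma wHmod_label l : wHmod (label_mod l).
Proof.
case: l => [[] o]; first exact/wHmod_string/label_ev_fix.
exact/wHmod_simple/label_ev_fix.
Qed.

Lemma label_split M : wHmod M -> (0 < rdim M)%N ->
  exists l, exists M', [/\ wHmod M', (rdim M' < rdim M)%N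
                         & mod_iso M (dsum (label_mod l) M')].
Proof.
move=> hM dM; have [MZ MZX MXX] := hM.
have q_n0 := prim_root_neq0 q_prim.
(* It suffices to embed an indecomposable by [U] with an intertwining left inverse [V]. *)
suff [l [U [V [VU [ZU XU] [VZ VX]]]]] : exists l,
    exists U : 'M_(rdim M, rdim (label_mod l)),
    exists V : 'M_(rdim (label_mod l), rdim M),
    [/\ V *m U = 1%:M,
        rZ M *m U = U *m rZ (label_mod l) /\ rX M *m U = U *m rX (label_mod l) &
        V *m rZ M = rZ (label_mod l) *m V /\ V *m rX M = rX (label_mod l) *m V].
  have [M' [_ hM' dM' isoM]] := retract_dsum hM VU ZU XU VZ VX.
  exists l, M'; split=> //; rewrite dM' /label_mod -[X in (X < _)%N]add0n ltn_add2r.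
  by case: l.1.
have [X0|X_n0] := eqVneq (rX M) 0.
  (* For X = 0, left and right eigenvectors with nonzero pairing share their eigenvalue and, once
     normalized, split off a simple summand. *)
  have I_n0 : (1%:M : 'M[k]_(rdim M)) != 0 by rewrite -mxrank_eq0 mxrank1 -lt0n.
  have [o [u [uZ]]] := eigen_row MZ I_n0; rewrite mulmx1 => u_n0.
  have [o' [v [Zv uv_n0]]] := eigen_col MZ u_n0.
  have [c uv] : exists c, u *m v = c%:M by exists ((u *m v) 0 0); apply: mx11_scalar.
  have c_n0 : c != 0 by apply: contraNneq uv_n0 => c0; rewrite uv c0 raddf0.
  have oo' : label_ev o' = label_ev o.
    have := mulmxA u (rZ M) v; rewrite Zv uZ -scalemxAr -scalemxAl => /eqP.
    by rewrite -subr_eq0 -scalerBl scaler_eq0 (negPf uv_n0) orbF subr_eq0 => /eqP.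
  exists (false, o), (c^-1 *: v), u; rewrite X0 /= !(mulmx0, mul0mx); split.
  - by rewrite -scalemxAr uv scale_scalar_mx mulVf.
  - by rewrite -scalemxAr Zv oo' mul_mx_scalar scalerA mulrC -scalerA.
  - by rewrite uZ mul_scalar_mx.
(* Here [v] is an eigenvector not killed by X, and [u] is a left eigenvector detecting Xv; ZX = qXZ
   forces the eigenvalue of [u] to be q times that of [v]. *)
have [o [v [Zv Xv_n0]]] := eigen_col MZ X_n0.
have [o' [u [uZ uXv_n0]]] := eigen_row MZ Xv_n0.
have [c uXv] : exists c, u *m (rX M *m v) = c%:M.
  by exists ((u *m (rX M *m v)) 0 0); apply: mx11_scalar.
have [e uv] : exists e, u *m v = e%:M by exists ((u *m v) 0 0); apply: mx11_scalar.
have c_n0 : c != 0 by apply: contraNneq uXv_n0 => c0; rewrite uXv c0 raddf0.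
set lam := label_ev o in Zv.
have oo' : label_ev o' = q * lam.
  have := mulmxA u (rZ M) (rX M *m v); rewrite uZ -scalemxAl (mulmxA (rZ M)) MZX.
  rewrite -(scalemxAl _ _ v) -mulmxA Zv -!scalemxAr scalerA => /esym/eqP.
  by rewrite -subr_eq0 -scalerBl scaler_eq0 (negPf uXv_n0) orbF subr_eq0 => /eqP.
(* Evaluating uZv in both ways gives q lam e = lam e, and q differs from 1. *)
have lam_e : lam * e = 0.
  have := mulmxA u (rZ M) v; rewrite uZ Zv oo' -scalemxAl -scalemxAr uv.
  rewrite !scale_scalar_mx => /matrixP/(_ 0 0); rewrite !mxE /= !mulr1n => /eqP.
  rewrite -mulrA -subr_eq0 -[X in X - _]mul1r -mulrBl mulf_eq0 subr_eq0 eq_sym.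
  by rewrite (negPf (prim_root_neq1 q_prim)) => /eqP.
(* For [lam = 0] the pairing [u *m v] may be nonzero; the correction term
   makes the coordinate functionals dual to [v'] and [X v']. *)
pose v' := c^-1 *: v - (c^-1 * c^-1 * e) *: (rX M *m v).
have XXv : rX M *m (rX M *m v) = 0 by rewrite mulmxA MXX mul0mx.
have Xv' : rX M *m v' = c^-1 *: (rX M *m v).
  by rewrite mulmxBr -!scalemxAr XXv scaler0 subr0.
have uXv' : u *m (rX M *m v') = 1%:M by rewrite Xv' -scalemxAr uXv scale_scalar_mx mulVf.
have uv' : u *m v' = 0.
  rewrite mulmxBr -!scalemxAr uv uXv !scale_scalar_mx -raddfB /=.
  by rewrite (mulrAC _ e) divfK // subrr raddf0.
have ZXv : rZ M *m (rX M *m v) = (q * lam) *: (rX M *m v).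
  by rewrite mulmxA MZX -scalemxAl -mulmxA Zv -scalemxAr scalerA.
have Zv' : rZ M *m v' = lam *: v'.
  rewrite mulmxBr -!scalemxAr Zv ZXv scalerBr !scalerA mulrC; congr (_ - _ *: _).
  by rewrite (mulrCA lam) lam_e -(mulrA _ e) (mulrCA e) (mulrC e) lam_e !mulr0.
have uXZ : u *m rX M *m rZ M = lam *: (u *m rX M).
  apply: (scalerI q_n0); rewrite -mulmxA scalemxAr -MZX mulmxA uZ oo'.
  by rewrite -scalemxAl scalerA.
(* The columns v', Xv' span a copy of M(lam); the rows uX, u are dual to them and span a space of
   functionals stable under Z and X, so the copy splits off. *)
exists (true, o), (row_mx v' (rX M *m v')), (col_mx (u *m rX M) u) => /=.
rewrite -/lam; split; [|split|split].
- rewrite mul_col_row -!mulmxA uXv' uv' Xv' -!scalemxAr XXv mulmx0 scaler0.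
  by rewrite -scalar_mx_block.
- rewrite mul_mx_row mul_row_block !mulmx0 addr0 add0r !mul_mx_scalar Zv' Xv'.
  by rewrite -scalemxAr ZXv !scalerA mulrC.
- rewrite mul_mx_row mul_row_block !mulmx0 addr0 add0r !mulmx1.
  by rewrite Xv' -scalemxAr XXv scaler0.
- rewrite mul_col_mx mul_block_col !mul0mx addr0 add0r !mul_scalar_mx.
  by rewrite uXZ uZ oo'.
- rewrite mul_col_mx mul_block_col !mul0mx !addr0 mul1mx.
  by rewrite -mulmxA MXX mulmx0.
Qed.

End Indecomposables.

(** * Rank invariants *)

(** Additive isomorphism invariants descend to homomorphisms on the Green ring; they serve to prove
    linear independence. *)
Lemma green_eq_sum (k : fieldType) n (q : k) (F : rawmod k -> nat) :
  (forall M N, mod_iso M N -> F M = F N) ->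
  (forall M N, F (dsum M N) = (F M + F N)%N) ->
  forall s t : fsum k, green_eq n q s t ->
  \sum_(p <- s) p.1 * (F p.2)%:Z = \sum_(p <- t) p.1 * (F p.2)%:Z.
Proof.
move=> F_iso F_dsum s t.
elim=> {s t} //= [s t u _ -> _ ->|s1 s2 t1 t2 _ IH1 _ IH2|x y|c d M|M
                 |c M N _ _ MN|c M N _ _] //.
- by rewrite !big_cat IH1 IH2.
- by rewrite !big_cons !big_nil !addr0 addrC.
- by rewrite !big_cons !big_nil !addr0 mulrDl.
- by rewrite big_cons !big_nil mul0r addr0.
- by rewrite !big_cons !big_nil (F_iso _ _ MN).
- by rewrite !big_cons !big_nil F_dsum PoszD mulrDr addrA.
Qed.

Section RankInvariants.
Variables (k : fieldType) (n : nat) (q : k).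
Hypothesis q_prim : (2 * n).-primitive_root q.
Implicit Types (M : rawmod k).
Notation ev := (@label_ev k n q).

Definition annih_mx (s : seq k) d (A : 'M[k]_d) : 'M_d :=
  foldr (fun mu B => (A - mu%:M) *m B) 1%:M s.

Lemma annih_mx_intertwine s d e (P : 'M[k]_(e, d)) A B :
  P *m A = B *m P -> P *m annih_mx s A = annih_mx s B *m P.
Proof.
move=> PA; elim: s => [|mu s IHs] /=; first by rewrite mulmx1 mul1mx.
by rewrite mulmxA mulmxBr PA mul_mx_scalar -mul_scalar_mx -mulmxBl -!mulmxA IHs.
Qed.

Lemma annih_mx_block s d e (A : 'M[k]_d) (B : 'M[k]_e) :
  annih_mx s (block_mx A 0 0 B) = block_mx (annih_mx s A) 0 0 (annih_mx s B).
Proof.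
elim: s => [|mu s IHs] /=; first exact: scalar_mx_block.
rewrite IHs [X in _ - X]scalar_mx_block opp_block_mx add_block_mx mulmx_block.
by rewrite !subr0 !(mulmx0, mul0mx, addr0, add0r).
Qed.

Lemma annih_mx_scalar s d (c : k) :
  annih_mx s (c%:M : 'M_d) = (\prod_(mu <- s) (c - mu))%:M.
Proof.
elim: s => [|mu s IHs] /=; first by rewrite big_nil.
by rewrite IHs big_cons -raddfB -scalar_mxM.
Qed.

Definition other_evs o := [seq ev o' | o' <- enum {: option 'I_(2 * n)} & o' != o].

Lemma other_evs_prod_eq0 o o' : (\prod_(mu <- other_evs o) (ev o' - mu) == 0) = (o' != o).
Proof.
rewrite prodf_seq_eq0; apply/hasP/idP=> [[_ /mapP[o2 + ->]]|o'o].
  by rewrite mem_filter subr_eq0 /= => /andP[o2o _] /eqP/(label_ev_inj q_prim)->.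
exists (ev o'); last by rewrite /= subrr.
by apply/mapP; exists o'; rewrite // mem_filter o'o mem_enum.
Qed.

(** On a module the matrix is a nonzero multiple of the projection onto the [ev o]-eigenspace of Z,
    so this is the multiplicity of the eigenvalue, and [evX_rank] is the rank of X on that
    eigenspace. *)
Definition ev_rank o M : nat := \rank (annih_mx (other_evs o) (rZ M)).
Definition evX_rank o M : nat := \rank (rX M *m annih_mx (other_evs o) (rZ M)).

Lemma mxrank_conj d e (P : 'M[k]_(e, d)) Q (A : 'M_d) (B : 'M_e) :
  Q *m P = 1%:M -> P *m Q = 1%:M -> P *m A = B *m P -> \rank A = \rank B.
Proof.
move=> QP PQ PA; apply/eqP; rewrite eqn_leq; apply/andP; split.
  have -> : A = Q *m B *m P by rewrite -mulmxA -PA mulmxA QP mul1mx.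
  by rewrite (leq_trans (mxrankM_maxl _ _)) ?mxrankM_maxr.
have -> : B = P *m A *m Q by rewrite PA -mulmxA PQ mulmx1.
by rewrite (leq_trans (mxrankM_maxl _ _)) ?mxrankM_maxr.
Qed.

Lemma ev_rank_iso o M N : mod_iso M N -> ev_rank o M = ev_rank o N.
Proof.
by case/mod_isoP=> P [Q [PQ QP PZ _]]; apply/(mxrank_conj QP PQ)/annih_mx_intertwine.
Qed.

Lemma evX_rank_iso o M N : mod_iso M N -> evX_rank o M = evX_rank o N.
Proof.
case/mod_isoP=> P [Q [PQ QP PZ PX]]; apply: (mxrank_conj QP PQ).
by rewrite mulmxA PX -!mulmxA (annih_mx_intertwine _ PZ).
Qed.

Lemma ev_rank_dsum o M N : ev_rank o (dsum M N) = (ev_rank o M + ev_rank o N)%N.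
Proof. by rewrite /ev_rank annih_mx_block rank_diag_block_mx. Qed.

Lemma evX_rank_dsum o M N : evX_rank o (dsum M N) = (evX_rank o M + evX_rank o N)%N.
Proof.
rewrite /evX_rank annih_mx_block mulmx_block !(mulmx0, mul0mx, addr0, add0r).
exact: rank_diag_block_mx.
Qed.

Lemma mxrank_scalar1 (c : k) : \rank (c%:M : 'M_1) = (c != 0).
Proof. by rewrite rank_rV -scalemx1 scaler_eq0 oner_eq0 orbF. Qed.

Lemma evX_rank_simple o o' : evX_rank o (@label_mod _ n q (false, o')) = 0%N.
Proof. by rewrite /evX_rank mul0mx mxrank0. Qed.

Lemma evX_rank_string o o' : evX_rank o (label_mod q (true, o')) = (o' == o).
Proof.
rewrite /evX_rank /= annih_mx_block mulmx_block !(mulmx0, mul0mx, addr0, add0r).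
rewrite mul1mx annih_mx_scalar block_mxEv row_mx0 rank_col_0mx rank_row_mx0.
by rewrite mxrank_scalar1 other_evs_prod_eq0 negbK.
Qed.

Lemma ev_rank_simple o o' : ev_rank o (label_mod q (false, o')) = (o' == o).
Proof.
by rewrite /ev_rank /= annih_mx_scalar mxrank_scalar1 other_evs_prod_eq0 negbK.
Qed.

End RankInvariants.

(** * Formal sums over a finite basis *)

(** These laws are shared by [green_eq] and by congruence modulo the relators, so the reduction to
    normal form is done once for both. *)
Record sum_congr (T : Type) (R : seq (int * T) -> seq (int * T) -> Prop) : Prop :=
  SumCongr {
    sc_refl : forall s, R s s;
    sc_sym : forall s t, R s t -> R t s;
    sc_trans : forall s t u, R s t -> R t u -> R s u;
    sc_cat : forall s1 s2 t1 t2, R s1 t1 -> R s2 t2 -> R (s1 ++ s2) (t1 ++ t2);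
    sc_swap : forall x y, R [:: x; y] [:: y; x];
    sc_merge : forall c d M, R [:: (c, M); (d, M)] [:: (c + d, M)];
    sc_zero : forall M, R [:: (0, M)] [::] }.

Section DeltaBasis.
Variable L : finType.

Definition delta (l : L) : {ffun L -> int} := [ffun l' => (l' == l)%:R].

Lemma sum_delta (v : {ffun L -> int}) : \sum_l delta l *~ v l = v.
Proof.
apply/ffunP=> l'; rewrite sum_ffunE (bigD1 l') //= ffunMzE ffunE eqxx intz.
rewrite big1 ?addr0 // => l ll'; rewrite ffunMzE ffunE eq_sym (negPf ll').
exact: mul0rz.
Qed.

Definition lin_ext (F : L -> {ffun L -> int}) (v : {ffun L -> int}) : {ffun L -> int} :=
  \sum_l F l *~ v l.

Lemma lin_extMz F v c : lin_ext F (v *~ c) = lin_ext F v *~ c.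
Proof.
rewrite /lin_ext mulrz_suml; apply: eq_bigr => l _.
by rewrite ffunMzE mulrzz mulrzA.
Qed.

Lemma lin_extD F u v : lin_ext F (u + v) = lin_ext F u + lin_ext F v.
Proof. by rewrite /lin_ext -big_split; apply: eq_bigr => l _; rewrite ffunE mulrzDr. Qed.

Lemma lin_ext0 F : lin_ext F 0 = 0.
Proof. by rewrite /lin_ext big1 // => l _; rewrite ffunE mulr0z. Qed.

Lemma lin_ext_sum F I (r : seq I) (E : I -> {ffun L -> int}) :
  lin_ext F (\sum_(i <- r) E i) = \sum_(i <- r) lin_ext F (E i).
Proof. exact: (big_morph _ (lin_extD F) (lin_ext0 F)). Qed.

Lemma lin_ext_delta F l : lin_ext F (delta l) = F l.
Proof.
rewrite /lin_ext (bigD1 l) //= ffunE eqxx mulr1z big1 ?addr0 // => l' l'l.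
by rewrite ffunE (negPf l'l) mulr0z.
Qed.

End DeltaBasis.

Section FormalSums.
Variables (T : Type) (R : seq (int * T) -> seq (int * T) -> Prop).
Hypothesis hR : sum_congr R.
Variables (L : finType) (m : L -> T).

Lemma sc_cons x s t : R s t -> R (x :: s) (x :: t).
Proof. by move=> st; apply: (sc_cat hR (sc_refl hR [:: x]) st). Qed.

Lemma sc_catl s t u : R s t -> R (s ++ u) (t ++ u).
Proof. by move=> st; apply: sc_cat => //; apply: sc_refl. Qed.

Lemma sc_catr s t u : R s t -> R (u ++ s) (u ++ t).
Proof. by move=> st; apply: sc_cat => //; apply: sc_refl. Qed.

Lemma sc_rot x s : R (x :: s) (s ++ [:: x]).
Proof.
elim: s => [|y s IHs] /=; first exact: sc_refl.
apply: (sc_trans hR) (sc_cons y IHs).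
exact: (sc_cat hR (sc_swap hR x y) (sc_refl hR s)).
Qed.

Lemma sc_catC s t : R (s ++ t) (t ++ s).
Proof.
elim: s t => [|x s IHs] t /=; first by rewrite cats0; apply: sc_refl.
apply: (sc_trans hR (sc_cons x (IHs t))).
by have := sc_catl s (sc_rot x t); rewrite -catA.
Qed.

Lemma sc_0 M s : R ((0, M) :: s) s.
Proof. exact: (sc_cat hR (sc_zero hR M) (sc_refl hR s)). Qed.

(** The formal negative [s'] of [s] is added to both sides. This is what later identifies the zero
    module with the empty sum. *)
Lemma sc_cancel s t : R s (s ++ t) -> R [::] t.
Proof.
pose s' := [seq (- p.1, p.2) | p <- s].
have ss' : R (s' ++ s) [::].
  rewrite /s'; elim: s {s'} => [|[c M] s IHs] /=; first exact: sc_refl.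
  apply: (sc_trans hR (sc_cons _ (sc_catC _ _))); rewrite /=.
  apply: (sc_trans hR (sc_catl _ (sc_merge hR (- c) c M))).
  by rewrite addNr /=; apply: (sc_trans hR (sc_0 _ _)); apply: sc_trans (sc_catC _ _) IHs.
move=> sst; apply: (sc_trans hR (sc_sym hR ss')).
apply: (sc_trans hR (sc_catr s' sst)); rewrite catA.
exact: (sc_catl t ss').
Qed.

Definition list_sum (v : {ffun L -> int}) (r : seq L) := [seq (v l, m l) | l <- r].
Definition basis_sum (v : {ffun L -> int}) := list_sum v (enum L).

Lemma basis_sum0 : R (basis_sum 0) [::].
Proof.
rewrite /basis_sum; elim: (enum L) => [|l r IHr] /=; first exact: sc_refl.
by rewrite ffunE; apply: sc_trans (sc_0 _ _) IHr.
Qed.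

Lemma basis_sumD u v : R (basis_sum u ++ basis_sum v) (basis_sum (u + v)).
Proof.
rewrite /basis_sum; elim: (enum L) => [|l r IHr] /=; first exact: sc_refl.
apply: (sc_trans hR (sc_cons _ (sc_catC _ _))); rewrite /= ffunE.
apply: (sc_trans hR (sc_catl _ (sc_merge hR _ _ _))); apply: sc_cons.
exact: sc_trans (sc_catC _ _) IHr.
Qed.

Lemma basis_sum_delta l c : R [:: (c, m l)] (basis_sum (delta l *~ c)).
Proof.
rewrite /basis_sum; have: l \in enum L by rewrite mem_enum.
have dE l' : (delta l *~ c) l' = if l' == l then c else 0.
  by rewrite ffunMzE ffunE; case: ifP => _; rewrite ?intz // mul0rz.
have nil r : l \notin r -> R [::] (list_sum (delta l *~ c) r).
  elim: r => [|l' r IHr] /=; first by move=> _; apply: sc_refl.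
  rewrite inE negb_or eq_sym => /andP[l'l lr]; rewrite dE (negPf l'l).
  exact: sc_trans (IHr lr) (sc_sym hR (sc_0 _ _)).
elim: (enum L) (enum_uniq L) => [|l' r IHr] //= /andP[l'r ur].
rewrite inE dE; have [ll'|ll'] /= := eqVneq l l'.
  by rewrite -ll' in l'r *; move=> _; apply/sc_cons/nil.
by move=> lr; apply: sc_trans (IHr ur lr) (sc_sym hR (sc_0 _ _)).
Qed.

Definition delta_sum (ls : seq L) : {ffun L -> int} := \sum_(l <- ls) delta l.

Lemma basis_sum_deltas ls c :
  R [seq (c, m l) | l <- ls] (basis_sum (delta_sum ls *~ c)).
Proof.
rewrite /delta_sum; elim: ls => [|l ls IHls] /=.
  by rewrite big_nil mul0rz; apply: (sc_sym hR basis_sum0).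
rewrite big_cons mulrzDl; apply: (sc_trans hR) (basis_sumD _ _).
exact: (sc_cat hR (basis_sum_delta l c) IHls).
Qed.

(** Two instances are intended: tensoring by generators, starting from the trivial module, and
    prepending letters, starting from the empty word. The lists in [tab] record multiplicities by
    repetition. *)
Variables (I : Type) (lam : I -> T -> T) (t0 : T) (tab : I -> L -> seq L) (l0 : L).
Hypothesis lamR : forall i s t, R s t ->
  R [seq (p.1, lam i p.2) | p <- s] [seq (p.1, lam i p.2) | p <- t].
Hypothesis lam_basis : forall i l c,
  R [:: (c, lam i (m l))] [seq (c, m l') | l' <- tab i l].
Hypothesis t0_basis : forall c, R [:: (c, t0)] [:: (c, m l0)].

Definition table_op i := lin_ext (fun l => delta_sum (tab i l)).
Definition word_nf (w : seq I) := foldr table_op (delta l0) w.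
Definition poly_nf (f : seq (int * seq I)) := \sum_(p <- f) word_nf p.2 *~ p.1.

Lemma basis_sum_op i v :
  R [seq (p.1, lam i p.2) | p <- basis_sum v] (basis_sum (table_op i v)).
Proof.
have -> : table_op i v = \sum_(l <- enum L) delta_sum (tab i l) *~ v l.
  by rewrite big_enum.
rewrite {1}/basis_sum; elim: (enum L) => [|l r IHr] /=.
  by rewrite big_nil; apply: (sc_sym hR basis_sum0).
rewrite big_cons; apply: (sc_trans hR) (basis_sumD _ _).
apply: (sc_cat hR (s1 := [:: _])) IHr.
exact: sc_trans (lam_basis _ _ _) (basis_sum_deltas _ _).
Qed.

Lemma word_nfP w c : R [:: (c, foldr lam t0 w)] (basis_sum (word_nf w *~ c)).
Proof.
elim: w => [|i w IHw] /=; first exact: sc_trans (t0_basis c) (basis_sum_delta _ _).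
rewrite -lin_extMz; apply: (sc_trans hR) (basis_sum_op i _).
exact: (lamR i IHw).
Qed.

Lemma poly_nfP f : R [seq (p.1, foldr lam t0 p.2) | p <- f] (basis_sum (poly_nf f)).
Proof.
rewrite /poly_nf; elim: f => [|p f IHf] /=.
  by rewrite big_nil; apply: (sc_sym hR basis_sum0).
rewrite big_cons; apply: (sc_trans hR) (basis_sumD _ _).
exact: (sc_cat hR (word_nfP _ _) IHf).
Qed.

End FormalSums.

(** * Products of the generators with the basis modules *)

Section LabelTable.
Variables (n : nat).

(** On eigenvalues this is multiplication by q: the successor wraps around because q^(2n) = 1, and
    [None] is fixed because it stands for 0. *)
Definition label_shift (o : option 'I_(2 * n)) := omap (@ordS (2 * n)) o.

Definition label_tab (j : 'I_3) (l : label n) : seq (label n) :=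
  match val j, l with
  | 0, (b, o) => [:: (b, label_shift o)]
  | 1, (false, o) => [:: (true, o)]
  | 1, (true, o) => [:: (true, o); (true, label_shift o)]
  | _, (false, _) => [:: (false, None)]
  | _, (true, _) => [:: (false, None); (false, None)]
  end.

Lemma label_ev_shift (k : fieldType) (q : k) o : (2 * n).-primitive_root q ->
  label_ev q (label_shift o) = q * label_ev q o.
Proof.
move=> q_prim; case: o => [i|] /=; last by rewrite mulr0.
by rewrite (prim_expr_mod q_prim) exprS.
Qed.

End LabelTable.

Section GeneratorProducts.
Variables (k : fieldType) (n : nat) (q a : k).
Hypothesis q_prim : (2 * n).-primitive_root q.
Notation wHmod := (is_wHmod n q).
Notation tens := (tens n q a).
Notation simple_mod := (@simple_mod k).
Notation string_mod := (@string_mod k q).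

Lemma M0_string : M0 q = string_mod 1.
Proof.
rewrite /M0 /string_mod mulr1; congr (@RawMod k 2 _ _); apply/matrixP.
  by case=> [[|[|[]]] // i] [[|[|[]]] // j]; rewrite !mxE;
    (do 2! (case: splitP => -[[|[]] // ?] /= ? //; rewrite ?mxE)).
by case=> [[|[|[]]] // i] [[|[|[]]] // j]; rewrite !mxE;
    (do 2! (case: splitP => -[[|[]] // ?] /= ? //; rewrite ?mxE)).
Qed.

Let q_n0 : q != 0 := prim_root_neq0 q_prim.
Let qn : q ^+ n = -1 := prim_root_half q_prim.

Lemma tens_S1_simple lam : tens (S1 q) (simple_mod lam) = simple_mod (q * lam).
Proof.
rewrite /Defs.tens /= !mulmx0 !tensmx0 tens0mx scaler0 !addr0.
congr (@RawMod k 1 _ _); apply/matrixP=> i j.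
by rewrite !ord1 !mxE /= !mulr1n.
Qed.

(** Z^n acts on S_1 by q^n = -1, so X comes out negated; conjugation by diag(1, -1) restores the
    sign. *)
Lemma tens_S1_string lam : mod_iso (tens (S1 q) (string_mod lam)) (string_mod (q * lam)).
Proof.
have -> : tens (S1 q) (string_mod lam) =
    @RawMod k (1 + 1) (rZ (string_mod (q * lam))) (- rX (string_mod (q * lam))).
  rewrite /Defs.tens /= !mulmx0 !tens0mx scaler0 addr0 add0r expmx_scalar qn.
  rewrite !tens_scalar_mx scaleN1r scale_block_mx !scaler0 !scale_scalar_mx.
  by congr (@RawMod k 2 _ _); rewrite castmx_id.
apply/mod_isoP; pose D : 'M[k]_(1 + 1) := block_mx 1%:M 0 0 (- 1%:M).
have DD : D *m D = 1%:M.
  rewrite mulmx_block !(mulmx0, mul0mx, addr0, add0r) mulmx1 mulmxN mulNmx mulmx1 opprK.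
  by rewrite -scalar_mx_block.
exists D, D; split=> //=.
  rewrite !mulmx_block !(mulmx0, mul0mx, addr0, add0r).
  by rewrite !(mulmxN, mulNmx, mulmx1, mul1mx).
rewrite mulmxN !mulmx_block !(mulmx0, mul0mx, addr0, add0r).
rewrite !(mulmxN, mulNmx, mulmx1, mul1mx).
by rewrite opp_block_mx !oppr0 opprK.
Qed.

Lemma tens_N0_simple lam : (0 < n)%N -> tens (N0 k) (simple_mod lam) = simple_mod 0.
Proof.
move=> n_gt0; rewrite /Defs.tens /= !mulmx0 !tens0mx scaler0 tensmx0 !addr0.
by congr (@RawMod k 1 _ _); rewrite raddf0.
Qed.

Lemma tens_N0_string lam : (0 < n)%N ->
  tens (N0 k) (string_mod lam) = dsum (simple_mod 0) (simple_mod 0).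
Proof.
move=> n_gt0; rewrite /Defs.tens /= !mulmx0 !tens0mx scaler0 !addr0 add0r.
(* Z^n acts on N_0 by 0^n, which is 0 only because n is positive. *)
rewrite expr0n gtn_eqF // tens0mx.
by rewrite /dsum /= raddf0 !block_mx0.
Qed.

Lemma tens_string1_simple lam : tens (string_mod 1) (simple_mod lam) = string_mod lam.
Proof.
rewrite /Defs.tens /= !mulmx0 !tensmx0 scaler0 !addr0 mulr1 tens_mx_scalar.
rewrite tens_mx_scalar scale1r scale_block_mx !scaler0 !scale_scalar_mx.
by congr (@RawMod k 2 _ _); rewrite castmx_id // mulr1 mulrC.
Qed.

(** In general e0 ⊗ e0 is not an eigenvector of Z, but adding [a] times e1 ⊗ e1 makes it one for
    every [lam]. The corrected vector generates M(lam), and e0 ⊗ e1 generates a complementary M(q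
    lam). *)
Lemma tens_string1_string lam :
  mod_iso (dsum (string_mod lam) (string_mod (q * lam)))
          (tens (string_mod 1) (string_mod lam)).
Proof.
pose e0 : 'cV[k]_(1 + 1) := col_mx 1%:M 0.
pose e1 : 'cV[k]_(1 + 1) := col_mx 0 1%:M.
pose f0 : 'rV[k]_(1 + 1) := row_mx 1%:M 0.
pose f1 : 'rV[k]_(1 + 1) := row_mx 0 1%:M.
pose E (x y : 'cV[k]_(1 + 1)) := tensmx x y.
pose F (x y : 'rV[k]_(1 + 1)) := tensmx x y.
have Zpow mu m : rZ (string_mod mu) ^+ m = block_mx (mu ^+ m)%:M 0 0 ((q * mu) ^+ m)%:M.
  by rewrite /= expmx_block !expmx_scalar.
have Ze0 mu m : rZ (string_mod mu) ^+ m *m e0 = mu ^+ m *: e0.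
  rewrite Zpow mul_block_col !(mulmx0, mul0mx, addr0, add0r).
  by rewrite scale_col_mx scaler0 scale_scalar_mx mulmx1 mulr1.
have Ze1 mu m : rZ (string_mod mu) ^+ m *m e1 = (q * mu) ^+ m *: e1.
  rewrite Zpow mul_block_col !(mulmx0, mul0mx, addr0, add0r).
  by rewrite scale_col_mx scaler0 scale_scalar_mx mulmx1 mulr1.
have Xe0 mu : rX (string_mod mu) *m e0 = e1.
  by rewrite /= mul_block_col !(mulmx0, mul0mx, addr0, add0r) mulmx1.
have Xe1 mu : rX (string_mod mu) *m e1 = 0.
  by rewrite /= mul_block_col !(mulmx0, mul0mx, addr0, add0r) col_mx0.
have FE x y z t : F x y *m E z t = tensmx (x *m z) (y *m t) by apply: tensmx_mul.
have ZE x y : rZ (tens (string_mod 1) (string_mod lam)) *m E x y =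
    tensmx (rZ (string_mod 1) *m x) (rZ (string_mod lam) *m y) +
    (a * (1 - q ^- 2)) *: tensmx (rZ (string_mod 1) ^+ n.+1 *m (rX (string_mod 1) *m x))
                                 (rZ (string_mod lam) *m (rX (string_mod lam) *m y)).
  by rewrite /E [rZ _]/= mulmxDl -scalemxAl !tensmx_mul !mulmxA.
have XE x y : rX (tens (string_mod 1) (string_mod lam)) *m E x y =
    tensmx (rX (string_mod 1) *m x) y +
    tensmx (rZ (string_mod 1) ^+ n *m x) (rX (string_mod lam) *m y).
  by rewrite /E [rX _]/= mulmxDl !tensmx_mul mul1mx.
(* Only here does the second term of the coproduct of Z contribute; Z^(n+1) acts on e1 in the first
   factor by q^(n+1) = -q. *)
have ZE00 : rZ (tens (string_mod 1) (string_mod lam)) *m E e0 e0 =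
    lam *: E e0 e0 - (a * (q ^+ 2 - 1) * lam) *: E e1 e1.
  rewrite ZE !Xe0 Ze1 -[rZ (string_mod 1)]expr1 -[rZ (string_mod lam)]expr1.
  rewrite !Ze0 Ze1 !expr1 !tensmxZl !tensmxZr scale1r !scalerA -scaleNr.
  by congr (_ + _ *: _); rewrite mulr1 (exprS q n) qn; field.
have ZE01 : rZ (tens (string_mod 1) (string_mod lam)) *m E e0 e1 = (q * lam) *: E e0 e1.
  rewrite ZE !Xe1 mulmx0 tensmx0 scaler0 addr0.
  rewrite -[rZ (string_mod 1)]expr1 -[rZ (string_mod lam)]expr1.
  by rewrite Ze0 Ze1 !expr1 tensmxZl scale1r tensmxZr.
have ZE10 : rZ (tens (string_mod 1) (string_mod lam)) *m E e1 e0 = (q * lam) *: E e1 e0.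
  rewrite ZE !Xe1 mulmx0 tens0mx scaler0 addr0.
  rewrite -[rZ (string_mod 1)]expr1 -[rZ (string_mod lam)]expr1.
  by rewrite Ze0 Ze1 !expr1 tensmxZl tensmxZr scalerA mulr1.
have ZE11 : rZ (tens (string_mod 1) (string_mod lam)) *m E e1 e1 =
    (q * (q * lam)) *: E e1 e1.
  rewrite ZE !Xe1 mulmx0 tens0mx scaler0 addr0.
  rewrite -[rZ (string_mod 1)]expr1 -[rZ (string_mod lam)]expr1.
  by rewrite !Ze1 !expr1 tensmxZl tensmxZr scalerA mulr1.
have XE00 : rX (tens (string_mod 1) (string_mod lam)) *m E e0 e0 = E e1 e0 + E e0 e1.
  by rewrite XE !Xe0 Ze0 expr1n scale1r.
have XE01 : rX (tens (string_mod 1) (string_mod lam)) *m E e0 e1 = E e1 e1.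
  by rewrite XE Xe0 Xe1 tensmx0 addr0.
have XE10 : rX (tens (string_mod 1) (string_mod lam)) *m E e1 e0 = - E e1 e1.
  by rewrite XE Xe0 Xe1 tens0mx add0r Ze1 mulr1 qn tensmxZl scaleN1r.
have XE11 : rX (tens (string_mod 1) (string_mod lam)) *m E e1 e1 = 0.
  by rewrite XE !Xe1 tens0mx tensmx0 addr0.
pose v1 := E e0 e0 + a *: E e1 e1; pose w1 := E e1 e0 + E e0 e1.
pose P := row_mx (row_mx v1 w1) (row_mx (E e0 e1) (E e1 e1)).
(* The rows of [Q] are dual to the columns of [P]; the term in [a] compensates the correction in
   [v1]. *)
pose Q := col_mx (col_mx (F f0 f0) (F f1 f0))
                 (col_mx (F f0 f1 - F f1 f0) (F f1 f1 - a *: F f0 f0)).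
have PZ : P *m rZ (dsum (string_mod lam) (string_mod (q * lam))) =
          rZ (tens (string_mod 1) (string_mod lam)) *m P.
  rewrite mul_row_block !mulmx0 addr0 add0r !mul_row_block !mulmx0 !addr0 !add0r.
  rewrite !mul_mx_scalar !mul_mx_row [in RHS]/v1 /w1 !mulmxDr -!scalemxAr.
  rewrite ZE00 ZE01 ZE10 ZE11 -scalerDr; congr (row_mx (row_mx _ _) _).
  rewrite /v1 scalerDr -addrA; congr (_ + _); rewrite !scalerA -scaleNr -scalerDl.
  by congr (_ *: _); ring.
have PX : P *m rX (dsum (string_mod lam) (string_mod (q * lam))) =
          rX (tens (string_mod 1) (string_mod lam)) *m P.
  rewrite mul_row_block !mulmx0 addr0 add0r !mul_row_block !mulmx0 !addr0 !add0r.
  rewrite !mulmx1 !mul_mx_row !mulmxDr -!scalemxAr.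
  by rewrite XE00 XE01 XE10 XE11 scaler0 addr0 addNr.
have f0e0 : f0 *m e0 = 1%:M by rewrite mul_row_col mulmx1 mul0mx addr0.
have f0e1 : f0 *m e1 = 0 by rewrite mul_row_col mulmx0 mul0mx addr0.
have f1e0 : f1 *m e0 = 0 by rewrite mul_row_col mulmx0 mul0mx addr0.
have f1e1 : f1 *m e1 = 1%:M by rewrite mul_row_col mulmx1 mul0mx add0r.
have FEs := (FE, f0e0, f0e1, f1e0, f1e1, tens0mx, tensmx0, tensmx11).
have QP : Q *m P = 1%:M.
  rewrite mul_col_row !mul_col_row /v1 /w1.
  rewrite !(mulmxDl, mulmxDr, mulNmx, mulmxN) -!scalemxAl -!scalemxAr !FEs.
  rewrite !(scaler0, addr0, add0r, oppr0, subr0).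
  by rewrite !subrr !block_mx0 -!scalar_mx_block.
apply: (@eq_dim_mod_iso _ (dsum (string_mod lam) (string_mod (q * lam)))
          (tens (string_mod 1) (string_mod lam)) P Q) => //.
by apply: mulmx1C.
Qed.

Lemma green_congr : sum_congr (@green_eq k n q).
Proof.
split; [exact: geq_refl|exact: geq_sym|exact: geq_trans|exact: geq_cat|
  exact: geq_swap|exact: geq_merge|exact: geq_zero].
Qed.

Lemma wHmod_gen j : wHmod (gen q j).
Proof.
case: j => -[|[|j]] lt_j; rewrite /gen /=.
- by apply: wHmod_simple; rewrite exprS (prim_expr_order q_prim) mulr1.
- by rewrite M0_string; apply: (wHmod_string q_prim); rewrite expr1n.
- by split; rewrite /= ?expr0n ?mulmx0 ?scaler0.
Qed.

Lemma green_table (n_gt0 : (0 < n)%N) j (l : label n) c :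
  green_eq n q [:: (c, tens (gen q j) (label_mod q l))]
               [seq (c, label_mod q l') | l' <- label_tab j l].
Proof.
have hl := wHmod_label q_prim; have ht := wHmod_tens a q_prim (wHmod_gen j) (hl l).
case: j => -[|[|j]] lt_j in ht *; case: l => [[] o] in ht *;
  rewrite /gen /label_tab /label_mod /= ?label_ev_shift // in ht *.
- apply: geq_iso (tens_S1_string _) => //.
  by have := hl (true, label_shift o); rewrite /label_mod /= label_ev_shift.
- by rewrite tens_S1_simple; apply: geq_refl.
- rewrite M0_string; rewrite M0_string in ht.
  have h1 := hl (true, o); have h2 := hl (true, label_shift o).
  rewrite /label_mod /= ?label_ev_shift // in h1 h2.
  apply: geq_trans (geq_dsum _ h1 h2); apply: geq_sym.
  by apply: geq_iso (tens_string1_string _) => //; apply: wHmod_dsum.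
- by rewrite M0_string tens_string1_simple; apply: geq_refl.
- by rewrite tens_N0_string //; apply: (geq_dsum _ (hl (false, None)) (hl (false, None))).
- by rewrite tens_N0_simple //; apply: geq_refl.
Qed.

End GeneratorProducts.

(** * The ideal of the relators *)

Section NCPolynomials.
Implicit Types (f g : ncpoly) (u v w : seq 'I_3).

Lemma ncoef_cons p f w : ncoef (p :: f) w = (p.2 == w)%:R * p.1 + ncoef f w.
Proof. by rewrite /ncoef big_cons; case: ifP => _; rewrite ?mul1r // mul0r add0r. Qed.

Lemma ncoef_nil w : ncoef [::] w = 0.
Proof. exact: big_nil. Qed.

Lemma ncoef_cat f g w : ncoef (f ++ g) w = ncoef f w + ncoef g w.
Proof. exact: big_cat. Qed.

Lemma ncoef_opp f w : ncoef [seq (- p.1, p.2) | p <- f] w = - ncoef f w.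
Proof. by rewrite /ncoef big_map sumrN. Qed.

Definition nc_shift (i : 'I_3) f : ncpoly := [seq (p.1, i :: p.2) | p <- f].

Lemma ncoef_shift i f w :
  ncoef (nc_shift i f) w = if w is j :: w' then (i == j)%:R * ncoef f w' else 0.
Proof.
elim: f => [|p f IHf] /=; first by case: w => [|j w]; rewrite !ncoef_nil ?mulr0.
rewrite ncoef_cons {}IHf; case: w => [|j w] /=; first by rewrite mul0r addr0.
by rewrite ncoef_cons eqseq_cons -mulnb natrM; ring.
Qed.

Lemma ncmul_monol c u f : ncmul [:: (c, u)] f = [seq (c * r.1, u ++ r.2) | r <- f].
Proof. by rewrite /ncmul /= cats0. Qed.

Lemma ncmul_monor f v : ncmul f [:: (1, v)] = [seq (r.1, r.2 ++ v) | r <- f].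
Proof.
by rewrite /ncmul; elim: f => [|p f IHf] //=; rewrite IHf mulr1.
Qed.

(** Both sums are regrouped by word over a common list [S], so evaluations depend on the polynomial
    and not on the list presenting it. *)
Lemma eq_ncoef_sum (V : zmodType) (F : seq 'I_3 -> V) f g :
  (forall w, ncoef f w = ncoef g w) ->
  \sum_(p <- f) F p.2 *~ p.1 = \sum_(p <- g) F p.2 *~ p.1.
Proof.
move=> fg; pose S := undup (map snd (f ++ g)).
have sumS h : {subset map snd h <= S} ->
    \sum_(p <- h) F p.2 *~ p.1 = \sum_(w <- S) F w *~ ncoef h w.
  move=> hS; transitivity (\sum_(w <- S) \sum_(p <- h | p.2 == w) F p.2 *~ p.1).
    rewrite (exchange_big_dep predT) //= big_seq [RHS]big_seq; apply: eq_bigr => p hp.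
    have pS : p.2 \in S by apply/hS/map_f.
    by rewrite (big_rem _ pS) /= eqxx big1_seq ?addr0 // => w /andP[/eqP<-];
      rewrite (mem_rem_uniq _ (undup_uniq _)) inE eqxx.
  apply: eq_bigr => w _; rewrite /ncoef mulrz_sumr.
  by apply: eq_bigr => p /eqP->.
rewrite !sumS; first by apply: eq_bigr => w _; rewrite fg.
  by move=> w; rewrite mem_undup map_cat mem_cat orbC => ->.
by move=> w; rewrite mem_undup map_cat mem_cat => ->.
Qed.

Variable n : nat.

Definition ideal_sum (e : seq (int * seq 'I_3 * 'I_7 * seq 'I_3)) : ncpoly :=
  flatten [seq ncmul [:: (x.1.1.1, x.1.1.2)] (ncmul (relator n x.1.2) [:: (1, x.2)])
          | x <- e].

(** Congruence modulo the ideal, written without subtraction; for [g] empty it is membership in the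
    ideal. *)
Definition ideal_eq f g :=
  exists e, forall w, ncoef f w = ncoef g w + ncoef (ideal_sum e) w.

Lemma ideal_eq_coef f g : (forall w, ncoef f w = ncoef g w) -> ideal_eq f g.
Proof. by move=> fg; exists [::] => w; rewrite fg ncoef_nil addr0. Qed.

Lemma ideal_sum_cat e1 e2 : ideal_sum (e1 ++ e2) = ideal_sum e1 ++ ideal_sum e2.
Proof. by rewrite /ideal_sum map_cat flatten_cat. Qed.

Lemma ideal_congr : sum_congr ideal_eq.
Proof.
split.
- by move=> f; apply: ideal_eq_coef.
- move=> f g [e fg]; exists [seq (- x.1.1.1, x.1.1.2, x.1.2, x.2) | x <- e] => w.
  rewrite fg; suff -> : ideal_sum [seq (- x.1.1.1, x.1.1.2, x.1.2, x.2) | x <- e] =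
      [seq (- p.1, p.2) | p <- ideal_sum e] by rewrite ncoef_opp addrK.
  rewrite /ideal_sum map_flatten -!map_comp; congr flatten; apply: eq_map => x /=.
  by rewrite !ncmul_monol -map_comp; apply: eq_map => r /=; rewrite mulNr.
- move=> f g h [e fg] [e' gh]; exists (e' ++ e) => w.
  by rewrite fg gh ideal_sum_cat ncoef_cat addrA.
- move=> f1 f2 g1 g2 [e1 fg1] [e2 fg2]; exists (e1 ++ e2) => w.
  by rewrite ideal_sum_cat !ncoef_cat fg1 fg2 addrACA.
- by move=> x y; apply: ideal_eq_coef => w; rewrite !ncoef_cons ncoef_nil; ring.
- by move=> c d M; apply: ideal_eq_coef => w; rewrite !ncoef_cons ncoef_nil /=; ring.
- by move=> M; apply: ideal_eq_coef => w; rewrite !ncoef_cons ncoef_nil /=; ring.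
Qed.

Definition ideal_trans := sc_trans ideal_congr.

(** The letter is absorbed into the left monomials of the witness. *)
Lemma ideal_eq_shift i f g : ideal_eq f g -> ideal_eq (nc_shift i f) (nc_shift i g).
Proof.
case=> e fg; exists [seq (x.1.1.1, i :: x.1.1.2, x.1.2, x.2) | x <- e] => w.
have -> : ideal_sum [seq (x.1.1.1, i :: x.1.1.2, x.1.2, x.2) | x <- e] =
    nc_shift i (ideal_sum e).
  rewrite /ideal_sum /nc_shift map_flatten -!map_comp; congr flatten.
  by apply: eq_map => x /=; rewrite !ncmul_monol -map_comp.
rewrite !ncoef_shift; case: w => [|j w]; first by rewrite addr0.
by rewrite fg mulrDr.
Qed.

Lemma ideal_eq_shifts u f g : ideal_eq f g ->
  ideal_eq [seq (p.1, u ++ p.2) | p <- f] [seq (p.1, u ++ p.2) | p <- g].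
Proof.
move=> fg; elim: u => [|i u IHu] /=.
  by rewrite !(@eq_map _ _ _ id) ?map_id // => -[].
by have := ideal_eq_shift i IHu; rewrite /nc_shift -!map_comp.
Qed.

Lemma ideal_eq_relator (j : 'I_7) c v f g :
  (forall w, ncoef f w =
     ncoef g w + ncoef [seq (c * r.1, r.2 ++ v) | r <- relator n j] w) ->
  ideal_eq f g.
Proof.
move=> fg; exists [:: (c, [::], j, v)] => w.
by rewrite fg /ideal_sum /= cats0 ncmul_monol ncmul_monor -map_comp.
Qed.


Ltac by_relator j c v :=
  apply: (@ideal_eq_relator (@Ordinal 7 j isT) c v) => w /=;
  rewrite ?(ncoef_cons, ncoef_nil) /=; ring.

Lemma ideal_x1N c v : ideal_eq [:: (c, nseq (2 * n) x1 ++ v)] [:: (c, v)].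
Proof. by_relator 0%N c v. Qed.

Lemma ideal_x2x2 c v :
  ideal_eq [:: (c, [:: x2, x2 & v])] [:: (c, [:: x1, x2 & v]); (c, x2 :: v)].
Proof. by_relator 1%N c v. Qed.

Lemma ideal_x2x1 c v : ideal_eq [:: (c, [:: x2, x1 & v])] [:: (c, [:: x1, x2 & v])].
(* The relator is x1 x2 - x2 x1 while the term rewritten is x2 x1, hence the sign. *)
Proof. by_relator 2%N (- c) v. Qed.

Lemma ideal_x3x3 c v : ideal_eq [:: (c, [:: x3, x3 & v])] [:: (c, x3 :: v)].
Proof. by_relator 3%N c v. Qed.

Lemma ideal_x1x3 c v : ideal_eq [:: (c, [:: x1, x3 & v])] [:: (c, x3 :: v)].
Proof. by_relator 4%N c v. Qed.

Lemma ideal_x3x1 c v : ideal_eq [:: (c, [:: x3, x1 & v])] [:: (c, x3 :: v)].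
Proof. by_relator 5%N c v. Qed.

Lemma ideal_x3x2 c v :
  ideal_eq [:: (c, [:: x3, x2 & v])] [:: (c, x3 :: v); (c, x3 :: v)].
Proof. by_relator 6%N c v. Qed.

Lemma ideal_x2x1X i c v :
  ideal_eq [:: (c, x2 :: nseq i x1 ++ v)] [:: (c, nseq i x1 ++ x2 :: v)].
Proof.
elim: i => [|i IHi] /=; first exact: (sc_refl ideal_congr).
apply: (sc_trans ideal_congr (ideal_x2x1 _ _)); exact: (ideal_eq_shift x1 IHi).
Qed.

Lemma ideal_x3x1X i c v : ideal_eq [:: (c, x3 :: nseq i x1 ++ v)] [:: (c, x3 :: v)].
Proof.
elim: i => [|i IHi] /=; first exact: (sc_refl ideal_congr).
exact: (sc_trans ideal_congr (ideal_x3x1 _ _) IHi).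
Qed.

(** The successor wraps around exactly when the power of x1 reaches 2n, where the first relator
    removes it. *)
Lemma ideal_x1X_mod (i : 'I_(2 * n)) c v :
  ideal_eq [:: (c, x1 :: nseq i x1 ++ v)] [:: (c, nseq (ordS i) x1 ++ v)].
Proof.
rewrite /=; have [i_lt|] := ltnP i.+1 (2 * n).
  by rewrite modn_small //; apply: (sc_refl ideal_congr).
move=> i_ge; have -> : i.+1 = (2 * n)%N by apply/eqP; rewrite eqn_leq i_ge andbT ltn_ord.
rewrite modnn -[x1 :: _]/(nseq i.+1 x1 ++ v).
have -> : i.+1 = (2 * n)%N by apply/eqP; rewrite eqn_leq i_ge andbT ltn_ord.
exact: ideal_x1N.
Qed.

Definition label_word (l : label n) : seq 'I_3 :=
  match l with
  | (b, Some i) => nseq i x1 ++ (if b then [:: x2] else [::])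
  | (b, None) => (if b then [:: x2] else [::]) ++ [:: x3]
  end.

Lemma ideal_table j l c :
  ideal_eq [:: (c, j :: label_word l)] [seq (c, label_word l') | l' <- label_tab j l].
Proof.
have rf := sc_refl ideal_congr.
have cc := sc_cat ideal_congr; have sw := sc_swap ideal_congr.
case: j => -[|[|[|j]]] lt_j //=;
  [have -> : Ordinal lt_j = x1 by apply: val_inj
  |have -> : Ordinal lt_j = x2 by apply: val_inj
  |have -> : Ordinal lt_j = x3 by apply: val_inj]; case: l => [[] [i|]] /=.
- exact: ideal_x1X_mod.
(* x1 x2 x3 = x2 x1 x3 = x2 x3: x1 must first be brought next to x3. *)
- apply: ideal_trans (sc_sym ideal_congr (ideal_x2x1 _ _)) _.
  exact: (ideal_eq_shift x2 (ideal_x1x3 _ _)).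
- exact: ideal_x1X_mod.
- exact: ideal_x1x3.
(* x2 is moved past the power of x1, its square is expanded there, and the two terms are put in the
   order of the table. *)
- apply: ideal_trans (ideal_x2x1X _ _ _) _.
  apply: ideal_trans (ideal_eq_shifts (nseq i x1) (ideal_x2x2 c [::])) _ => /=.
  apply: ideal_trans (sw _ _) _; apply: (cc [:: _] [:: _] [:: _] [:: _]) => //.
  have nseqSr m v : nseq m x1 ++ x1 :: v = x1 :: nseq m x1 ++ v.
    by elim: m => //= m ->.
  by rewrite nseqSr; apply: ideal_x1X_mod.
- apply: ideal_trans (ideal_x2x2 _ _) _; apply: ideal_trans (sw _ _) _.
  apply: (cc [:: _] [:: _] [:: _] [:: _]) => //.
  apply: ideal_trans (sc_sym ideal_congr (ideal_x2x1 _ _)) _.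
  exact: (ideal_eq_shift x2 (ideal_x1x3 _ _)).
- by rewrite cats0; have := ideal_x2x1X i c [::]; rewrite cats0.
- exact: rf.
- exact: ideal_trans (ideal_x3x1X _ _ _) (ideal_x3x2 _ _).
- apply: ideal_trans (ideal_x3x2 _ _) _.
  by apply: (cc [:: _] [:: _] [:: _] [:: _]); apply: ideal_x3x3.
- exact: ideal_x3x1X.
- exact: ideal_x3x3.
Qed.

(** * Action of words on the free abelian group on the labels *)

Notation op := (table_op (@label_tab n)).

(** The starting vector is arbitrary because a relator inside a product acts on whatever the word to
    its right has produced. *)
Definition word_act (x : {ffun label n -> int}) (w : seq 'I_3) := foldr op x w.

Definition poly_act f x := \sum_(p <- f) word_act x p.2 *~ p.1.

Lemma word_actMz x w c : word_act (x *~ c) w = word_act x w *~ c.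
Proof. by elim: w => //= i w ->; apply: lin_extMz. Qed.

Lemma word_act_sum J (r : seq J) (E : J -> {ffun label n -> int}) w :
  word_act (\sum_(i <- r) E i) w = \sum_(i <- r) word_act (E i) w.
Proof. by elim: w => //= i w ->; apply: lin_ext_sum. Qed.

Lemma poly_act_delta f x : (forall l, poly_act f (delta l) = 0) -> poly_act f x = 0.
Proof.
move=> f0; rewrite -[x]sum_delta /poly_act.
under eq_bigr => p _ do rewrite word_act_sum mulrz_suml.
rewrite exchange_big big1 // => l _.
under eq_bigr => p _ do rewrite word_actMz mulrzAC.
by rewrite -mulrz_suml -/(poly_act f (delta l)) f0 mul0rz.
Qed.

Lemma val_iter_ordS N (i : 'I_N) m : iter m (@ordS N) i = ((i + m) %% N)%N :> nat.
Proof.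
elim: m => [|m IHm] /=; first by rewrite addn0 modn_small.
by rewrite IHm -addn1 modnDml addn1 addnS.
Qed.

Lemma op_x1 b o : op x1 (delta (b, o)) = delta (b, label_shift o).
Proof. by rewrite /table_op lin_ext_delta /delta_sum /= big_seq1. Qed.

Lemma op_x2_simple o : op x2 (delta (false, o)) = delta (true, o).
Proof. by rewrite /table_op lin_ext_delta /delta_sum /= big_seq1. Qed.

Lemma op_x2_string o :
  op x2 (delta (true, o)) = delta (true, o) + delta (true, label_shift o).
Proof. by rewrite /table_op lin_ext_delta /delta_sum /= big_cons big_seq1. Qed.

Lemma op_x3_simple o : op x3 (delta (false, o)) = delta (false, None).
Proof. by rewrite /table_op lin_ext_delta /delta_sum /= big_seq1. Qed.

Lemma op_x3_string o : op x3 (delta (true, o)) = delta (false, None) *+ 2.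
Proof. by rewrite /table_op lin_ext_delta /delta_sum /= big_cons big_seq1 mulr2n. Qed.

Lemma word_act_x1X m b o :
  word_act (delta (b, o)) (nseq m x1) = delta (b, omap (iter m (@ordS (2 * n))) o).
Proof.
by elim: m => [|m IHm] /=; [case: o | rewrite IHm op_x1; case: o {IHm}].
Qed.

(** Every basis vector is realized by a word, so a polynomial with any prescribed normal form can be
    written down. The index of value 0 labels the unit S(1). *)
Lemma word_nf_label_word (i0 : 'I_(2 * n)) l : i0 = 0%N :> nat ->
  word_nf (@label_tab n) (false, Some i0) (label_word l) = delta l.
Proof.
move=> i0E; case: l => b [i|] /=; last first.
  by case: b; rewrite /word_nf /= op_x3_simple // op_x2_simple.
rewrite /word_nf foldr_cat.
have -> : foldr op (delta (false, Some i0)) (if b then [:: x2] else [::]) =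
    delta (b, Some i0).
  by case: b; rewrite //= op_x2_simple.
rewrite -/(word_act _ _) word_act_x1X; congr (delta (b, Some _)); apply: val_inj.
by rewrite [LHS]val_iter_ordS i0E add0n modn_small.
Qed.

(** By linearity only basis vectors matter, and there the table decides; for the first relator, 2n
    cyclic shifts are the identity. *)
Lemma relator_act j x : poly_act (relator n j) x = 0.
Proof.
apply: poly_act_delta => l.
have opD i y z : op i (y + z) = op i y + op i z by apply: lin_extD.
have opx1N b o : word_act (delta (b, o)) (nseq (2 * n) x1) = delta (b, o).
  rewrite word_act_x1X; case: o => //= i; congr (delta (b, Some _)); apply: val_inj.
  by rewrite [LHS]val_iter_ordS modnDr modn_small.
case: l => [b o]; case: j => -[|[|[|[|[|[|j]]]]]] lt_j; rewrite /relator /poly_act /=;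
  rewrite ?(big_cons, big_nil) /= ?opx1N ?addr0 ?mulr1z ?mulrN1z.
all: case: b; rewrite /= ?(op_x1, op_x2_simple, op_x2_string, op_x3_simple,
                              op_x3_string, opD).
all: try by rewrite ?subrr // opprD addrA subrr.
all: by rewrite -!opprD [X in _ - X]addrC subrr.
Qed.

(** In a product u r v the word v acts first, the relator r kills the outcome whatever it is, and u
    preserves 0. *)
Lemma poly_nf_ideal f l0 : in_rel_ideal n f -> poly_nf (@label_tab n) l0 f = 0.
Proof.
case=> e fe; rewrite /poly_nf (eq_ncoef_sum _ fe).
rewrite big_flatten big_map big1 // => -[[[c u] j] v] _ /=.
rewrite ncmul_monol ncmul_monor -map_comp big_map /=.
transitivity (word_act (poly_act (relator n j) (word_nf (@label_tab n) l0 v)) u *~ c).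
  rewrite /poly_act word_act_sum mulrz_suml; apply: eq_bigr => r _.
  by rewrite /word_nf !foldr_cat word_actMz -mulrzA mulrC.
rewrite relator_act -[RHS](mul0rz _ c); congr (_ *~ _).
by elim: u => //= i u ->; rewrite /table_op lin_ext0.
Qed.

End NCPolynomials.

(** * The Green ring *)

Section GreenRing.
Variables (k : fieldType) (n : nat) (q a : k).
Hypothesis q_prim : (2 * n).-primitive_root q.
Hypothesis n_gt0 : (0 < n)%N.
Notation wHmod := (is_wHmod n q).
Notation green := (@green_eq k n q).
Notation lmod := (@label_mod k n q).
Notation gcongr := (green_congr n q).

Lemma green_basis_sum_inj v : green (basis_sum lmod v) [::] -> v = 0.
Proof.
move=> v0; have sumE F (F_iso : forall M N, mod_iso M N -> F M = F N)
    (F_dsum : forall M N, F (dsum M N) = (F M + F N)%N) :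
    \sum_b \sum_o v (b, o) * (F (lmod (b, o)))%:Z = 0.
  have := green_eq_sum F_iso F_dsum v0; rewrite big_nil big_map big_enum /= => sum0.
  by rewrite pair_big -[RHS]sum0; apply: eq_bigr => -[].
(* The rank of X on an eigenspace vanishes on simples and isolates one M(o). The eigenspace
   dimensions also see the M(o), so they are used only after these coefficients are known to
   vanish. *)
have string0 o : v (true, o) = 0.
  have := sumE _ (@evX_rank_iso k n q o) (@evX_rank_dsum k n q o).
  rewrite big_bool /= [X in _ + X]big1 => [|o' _]; last first.
    by rewrite evX_rank_simple mulr0.
  rewrite addr0 (bigD1 o) //= evX_rank_string // eqxx mulr1 big1 ?addr0 // => o' o'o.
  by rewrite evX_rank_string // (negPf o'o) mulr0.
apply/ffunP=> -[[] o]; rewrite [RHS]ffunE //.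
have := sumE _ (@ev_rank_iso k n q o) (@ev_rank_dsum k n q o).
rewrite big_bool /= [X in X + _]big1 => [|o' _]; last by rewrite string0 mul0r.
rewrite add0r (bigD1 o) //= ev_rank_simple // eqxx mulr1 big1 ?addr0 // => o' o'o.
by rewrite ev_rank_simple // (negPf o'o) mulr0.
Qed.

(** A zero module is isomorphic to its own double, so its class equals twice itself and cancels. *)
Lemma green_dim0 M c : wHmod M -> rdim M = 0%N -> green [::] [:: (c, M)].
Proof.
move=> hM dM; apply: (sc_cancel gcongr (s := [:: (c, M)])).
apply: geq_trans (geq_dsum c hM hM); apply: geq_iso => //; first exact: wHmod_dsum.
have flat r s (A B : 'M[k]_(r, s)) : r = 0%N -> A = B.
  by move=> r0; move: A B; rewrite r0 => A B; rewrite (flatmx0 A) (flatmx0 B).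
by apply/mod_isoP; exists 0, 0; split; apply: flat; rewrite //= dM.
Qed.

(** Indecomposables are split off by induction on the dimension; [v] is chosen before [c], so that
    one vector serves all multiples. *)
Lemma green_decomp M : wHmod M ->
  exists v, forall c, green [:: (c, M)] (basis_sum lmod (v *~ c)).
Proof.
move: {2}(rdim M).+1 (ltnSn (rdim M)) => d; elim: d M => // d IHd M.
rewrite ltnS => dM hM.
have [d0|d_gt0] := posnP (rdim M).
  exists 0 => c; rewrite mul0rz.
  exact: geq_trans (geq_sym (green_dim0 c hM d0)) (geq_sym (basis_sum0 gcongr lmod)).
have [l [M' [hM' dM' isoM]]] := label_split q_prim hM d_gt0.
have [|v Mv] := IHd M' _ hM'; first exact: leq_trans dM' dM.
exists (delta l + v) => c; rewrite mulrzDl.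
apply: geq_trans (basis_sumD gcongr lmod _ _).
have hl := wHmod_label q_prim l.
apply: geq_trans (geq_iso c hM (wHmod_dsum hl hM') isoM) _.
apply: geq_trans (geq_dsum c hl hM') _.
exact: geq_cat (basis_sum_delta gcongr lmod l c) (Mv c).
Qed.

Lemma green_decomp_fsum s : valid_fsum n q s -> exists v, green s (basis_sum lmod v).
Proof.
elim: s => [|[c M] s IHs] hs.
  by exists 0; apply: geq_sym; apply: (basis_sum0 gcongr).
have [|v sv] := IHs; first by move=> p ps; apply: hs; right.
have [u Mu] := green_decomp (hs (c, M) (or_introl erefl)).
exists (u *~ c + v); apply: geq_trans (basis_sumD gcongr lmod _ _).
exact: geq_cat (Mu c) sv.
Qed.

(** Every word goes to a single tensor product bracketed to the right, which is the [foldr] shape of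
    [poly_nfP]. *)
Lemma phiE f :
  phi n q a f =
  [seq (p.1, foldr (fun j M => tens n q a (gen q j) M) (triv k) p.2) | p <- f].
Proof.
have wordE w : phi_word n q a w =
    [:: (1, foldr (fun j M => tens n q a (gen q j) M) (triv k) w)].
  by elim: w => //= i w ->.
rewrite /phi; elim: f => //= p f ->; rewrite wordE /=.
by rewrite mulr1.
Qed.

Let i0 : 'I_(2 * n) := Ordinal (prim_order_gt0 q_prim).
(** The eigenvalue is q^0 = 1: this label stands for the trivial module and for the empty word. *)
Let l0 : label n := (false, Some i0).
Notation nf := (poly_nf (@label_tab n) l0).

Lemma green_nf f : green (phi n q a f) (basis_sum lmod (nf f)).
Proof.
rewrite phiE; apply: (poly_nfP gcongr (lam := fun j => tens n q a (gen q j))).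
- by move=> j s t; apply: green_tens => //; apply: wHmod_gen.
- by move=> j l c; apply: green_table.
- by move=> c; apply: geq_refl.
Qed.

Lemma ideal_nf f : ideal_eq n f (basis_sum (@label_word n) (nf f)).
Proof.
(* Prepending its letters to the empty word rebuilds a word, so [f] itself has the shape treated by
   [poly_nfP]. *)
have fE : [seq (p.1, foldr cons [::] p.2) | p <- f] = f.
  by rewrite -[RHS]map_id; apply: eq_map => -[c w] /=; congr (_, _); elim: w => //= i w ->.
rewrite -{1}fE; apply: (poly_nfP (ideal_congr n)).
- by move=> i s t; apply: ideal_eq_shift.
- exact: ideal_table.
- by move=> c; apply: (sc_refl (ideal_congr n)).
Qed.

Lemma nf_label_words (v : {ffun label n -> int}) :
  nf [seq (v l, label_word l) | l <- enum (label n)] = v.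
Proof.
rewrite /poly_nf big_map big_enum /= -[RHS]sum_delta; apply: eq_bigr => l _.
by rewrite word_nf_label_word.
Qed.

Lemma nf_eq0_ideal f : nf f = 0 -> in_rel_ideal n f.
Proof.
move=> f0; have := ideal_nf f; rewrite f0 => fP.
have [e fe] := sc_trans (ideal_congr n) fP (basis_sum0 (ideal_congr n) _).
by exists e => w; rewrite fe ncoef_nil add0r.
Qed.

End GreenRing.

Unset Implicit Arguments.

Theorem theorem4p4 (k : closedFieldType) (n : nat) (q a : k) :
  [pchar k] =i pred0 -> (0 < n)%N -> (2 * n).-primitive_root q -> a != 0 ->
  (* the map phi : Z<x1,x2,x3> -> r(A) is surjective ... *)
  (forall s : fsum k, valid_fsum n q s ->
     exists f : ncpoly, green_eq n q (phi n q a f) s) /\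
  (* ... and its kernel is exactly the two-sided ideal of the relators *)
  (forall f : ncpoly, green_eq n q (phi n q a f) [::] <-> in_rel_ideal n f).
Proof.
move=> _ n_gt0 q_prim _; split=> [s hs|f].
  have [v sv] := green_decomp_fsum q_prim hs.
  (* The preimage takes the coordinates of [s] as coefficients of the normal words. *)
  exists [seq (v l, label_word l) | l <- enum (label n)].
  have := green_nf a q_prim n_gt0 [seq (v l, label_word l) | l <- enum (label n)].
  rewrite nf_label_words => fv; exact: geq_trans fv (geq_sym sv).
(* The normal form of [f] also represents its image; it vanishes by independence of the basis
   classes when the image does, and by the action of the relators when [f] lies in the ideal. *)
have f_nf := green_nf a q_prim n_gt0 f.
split=> [f0|f_ideal].
  apply: (@nf_eq0_ideal _ _ _ q_prim); apply: (green_basis_sum_inj q_prim).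
  exact: geq_trans (geq_sym f_nf) f0.
apply: geq_trans f_nf _; rewrite (poly_nf_ideal _ f_ideal).
exact: (basis_sum0 (green_congr n q)).
Qed.
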